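(* Let $\mathcal{A}$ be a unital $C^*$-subalgebra of $M_d$ and let $\mathbf{E}_{\mathcal{A}}$ be the unique trace-preserving conditional expectation of $M_d$ onto $\mathcal{A}$. Fix any norm $\|\cdot\|$ on the space of linear maps on $M_d$. Then there exists $r_{\mathcal{A}}>0$ such that every $\Phi\in\mathcal{F}(\mathcal{A})$ with $\|\Phi-\mathbf{E}_{\mathcal{A}}\|\le r_{\mathcal{A}}$ is a mixed unitary channel.
   Context: $M_d$ denotes the complex $d\times d$ matrices, $\mathrm{Ad}_V(X)=V^*XV$. A unital quantum channel on $M_d$ is a completely positive, unital ($\Phi(I)=I$), trace-preserving linear map $M_d\to M_d$. It is mixed unitary if $\Phi=\sum_{j=1}^\ell\lambda_j\mathrm{Ad}_{U_j}$ with unitaries $U_j$, $\lambda_j\ge0$, $\sum_j\lambda_j=1$. A conditional expectation onto a unital $C^*$-subalgebra $\mathcal{A}\subseteq M_d$ is a completely positive map $\mathbf{E}:M_d\to M_d$ with range $\mathcal{A}$ and $\mathbf{E}(A)=A$ for all $A\in\mathcal{A}$; the unique trace-preserving one, $\mathbf{E}_{\mathcal{A}}$, is the orthogonal projection of $M_d$ onto $\mathcal{A}$ for the Hilbert–Schmidt inner product $\mathrm{tr}(X^*Y)$. $\mathcal{F}(\mathcal{A})$ denotes the set of unital quantum channels $\Phi$ on $M_d$ with $\Phi(A)=A$ for all $A\in\mathcal{A}$. *)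

(* Defs.v *)
From HB Require Import structures.
From mathcomp Require Import all_boot all_order all_algebra.
From mathcomp Require Import complex.
From mathcomp Require Import reals.
Set Implicit Arguments. Unset Strict Implicit. Unset Printing Implicit Defensive.
Import Order.TTheory GRing.Theory Num.Theory.
Local Open Scope ring_scope.
Local Open Scope sesquilinear_scope.

Section QDefs.
Variable R : realType.
Local Notation C := (R[i]).
Variable d : nat.

Definition Ad (V X : 'M[C]_d) : 'M[C]_d := V ^t* *m X *m V.

Definition psdmx n (M : 'M[C]_n) : Prop :=
  forall v : 'cV[C]_n, 0 <= (v ^t* *m M *m v) 0 0.

(* id_k (x) Phi acting on k x k block matrices with d x d blocks *)
Definition ampl k (Phi : 'M[C]_d -> 'M[C]_d)
  (M : 'M[C]_(\sum_(i < k) d)) : 'M[C]_(\sum_(i < k) d) :=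
  \mxblock_(i < k, j < k) Phi (submxblock (p_ := fun _ : 'I_k => d)
                                          (q_ := fun _ : 'I_k => d) M i j).

Definition linearP (Phi : 'M[C]_d -> 'M[C]_d) : Prop :=
  forall (a : C) (X Y : 'M[C]_d), Phi (a *: X + Y) = a *: Phi X + Phi Y.

Definition completely_positive (Phi : 'M[C]_d -> 'M[C]_d) : Prop :=
  forall (k : nat) (M : 'M[C]_(\sum_(i < k) d)), psdmx M -> psdmx (ampl Phi M).

Definition unital_channel (Phi : 'M[C]_d -> 'M[C]_d) : Prop :=
  [/\ linearP Phi, completely_positive Phi, Phi 1%:M = 1%:M
    & forall X, \tr (Phi X) = \tr X].

Definition mixed_unitary (Phi : 'M[C]_d -> 'M[C]_d) : Prop :=
  exists (l : nat) (lam : 'I_l -> C) (U : 'I_l -> 'M[C]_d),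
    [/\ forall j, U j \is unitarymx,
        forall j, 0 <= lam j,
        \sum_(j < l) lam j = 1
      & forall X, Phi X = \sum_(j < l) lam j *: Ad (U j) X].

(* unital C*-subalgebra of M_d (finite dimension: unital *-subalgebra) *)
Definition unital_Cstar_subalg (A : {pred 'M[C]_d}) : Prop :=
  [/\ 1%:M \in A,
      forall X Y, X \in A -> Y \in A -> X + Y \in A,
      forall (a : C) X, X \in A -> a *: X \in A,
      forall X Y, X \in A -> Y \in A -> X *m Y \in A
    & forall X, X \in A -> X ^t* \in A].

Definition HS_orth_proj (A : {pred 'M[C]_d}) (E : 'M[C]_d -> 'M[C]_d) : Prop :=
  forall X, E X \in A /\ (forall Y, Y \in A -> \tr (Y ^t* *m (X - E X)) = 0).

Definition fixing_channels (A : {pred 'M[C]_d}) (Phi : 'M[C]_d -> 'M[C]_d) : Prop :=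
  unital_channel Phi /\ forall X, X \in A -> Phi X = X.

(* a norm on the space of linear maps M_d -> M_d, the latter identified
   with 'M_(d*d, d*d) through lin_mx *)
Definition is_norm_linmaps (N : 'M[C]_(d * d, d * d) -> R) : Prop :=
  [/\ forall x, 0 <= N x,
      forall x, N x = 0 -> x = 0,
      forall (a : C) x, N (a *: x) = ComplexField.Normc.normc a * N x
    & forall x y, N (x + y) <= N x + N y].

Definition linmap_norm (N : 'M[C]_(d * d, d * d) -> R)
  (L : 'M[C]_d -> 'M[C]_d) : R := N (lin_mx L).

End QDefs.

(* Main.v *)
Require Import Defs.
From HB Require Import structures.
From mathcomp Require Import all_boot all_order all_algebra.
From mathcomp Require Import complex.
From mathcomp Require Import reals.
From mathcomp Require Import boolp classical_sets topology normedtype derive.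
From mathcomp Require Import ring.
Import Order.TTheory GRing.Theory Num.Theory.
Local Open Scope ring_scope.
Local Open Scope sesquilinear_scope.
Set Implicit Arguments. Unset Strict Implicit. Unset Printing Implicit Defensive.

(* If [Phi] fixes [A], its Kraus operators lie in the commutant [B] of [A].
   Such a doubly stochastic [Phi] is in the span of the [Ad u], [u] unitary in
   [B]: for a bilinear form [m] with [m (u ^t* ) u = 0] on unitaries, spectral
   projections give [m h h = m (h^2) 1] and [m (h^2) h = m (h^3) 1] for
   selfadjoint [h], and the separability idempotent of [B] (its Casimir element)
   then forces [m x y = h (x y) + g (y x)] on [B] with linear [h], [g]; hence
   [m] vanishes on [Phi].
   Averaging over finitely many spanning unitaries gives a selfadjoint mixture
   [p] whose fixed space is [A], by the bicommutant theorem, so that [p^n] tends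
   to [E].  For [Phi] close to [E] and [n] fixed, [Phi - p^(n+1)] is a small
   combination of the [Ad u]; distributing it over the terms [w Ad_W] of [p^n]
   leaves [Phi = sum_W w Ad_W (p + small)], and [p + small] is still a mixture
   since [p] has positive weights on a spanning set. *)

(** * Norms on matrices *)

(** The obstacle is a circularity. A small perturbation can be absorbed only by weights that are
    positive on a spanning family, but the weights of the expanded mixture [p^n] shrink
    geometrically with [n], while [n] must be large for [p^n] to be near [E]. Splitting off one
    factor [p] removes it: pulling the defect back by a unitary [W] costs a factor depending on the
    dimension alone, so the tolerance is dictated by [p] and is fixed before [n] is chosen. The
    forms [h (x y) + g (y x)] are those that the two normalisations of a doubly stochastic Kraus
    family can evaluate, since they see the operators only through the sums of [V^* V] and of
    [V V^*]. That no other form survives is a vanishing result of cyclic cohomology type: the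
    antisymmetric part of [m] is a cyclic cochain, and contraction with the Casimir element kills
    its Hochschild coboundary. *)

Section Lipschitz.
Import numFieldNormedType.Exports.

Lemma lipschitz_continuous (R : realType) (V : normedModType R) (f : V -> R) L :
  0 <= L -> (forall v w, `|f v - f w| <= L * `|v - w|) -> continuous f.
Proof.
move=> L0 lip v; have L1 : 0 < L + 1 by rewrite ltr_wpDl.
apply/cvgrPdist_le => e e0; near=> w.
apply: le_trans (lip _ _) _.
apply: le_trans (_ : (L + 1) * `|v - w| <= _).
  by rewrite ler_wpM2r // lerDl.
rewrite mulrC -ler_pdivlMr //; near: w.
by apply: cvgr_dist_le => //; rewrite divr_gt0.
Unshelve. all: by end_near. Qed.

End Lipschitz.

Section NormEquivalence.
Import numFieldNormedType.Exports.
Variable R : realType.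
Local Notation C := (R[i]).
Local Notation normc := ComplexField.Normc.normc.

Lemma normc_le_abs (a b : R) : normc (a +i* b)%C <= `|a| + `|b|.
Proof.
have -> : (a +i* b)%C = a%:C%C + (0 +i* b)%C.
  by rewrite /GRing.add /= addr0 add0r.
apply: le_trans (le_normcD _ _) _.
by rewrite /= expr0n /= addr0 add0r !sqrtr_sqr.
Qed.

Variable d : nat.
Local Notation n := (d * d)%N.
Variable N : 'M[C]_(n, n) -> R.
Hypothesis Nn : is_norm_linmaps N.

Let NZ a x : N (a *: x) = normc a * N x. Proof. by case: Nn. Qed.
Let ND x y : N (x + y) <= N x + N y. Proof. by case: Nn. Qed.
Let N_ge0 x : 0 <= N x. Proof. by case: Nn. Qed.
Let N_eq0 x : N x = 0 -> x = 0. Proof. by case: Nn => _ + _ _; apply. Qed.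
Let N0 : N 0 = 0.
Proof.
by rewrite -(scale0r (0 : 'M[C]_(n, n))) NZ ComplexField.Normc.normc0 mul0r.
Qed.
Let NN x : N (- x) = N x.
Proof.
by rewrite -scaleN1r NZ normcN ComplexField.Normc.normc1 mul1r.
Qed.

Let N_sum (I : finType) (F : I -> 'M[C]_(n, n)) :
  N (\sum_i F i) <= \sum_i N (F i).
Proof.
apply: (big_ind2 (fun x y => N x <= y)) => [|x y x' y' h h'|//]; first by rewrite N0.
by apply: le_trans (ND _ _) _; exact: lerD.
Qed.

Let N_le x : N x <= \sum_i \sum_j normc (x i j) * N (delta_mx i j).
Proof.
rewrite {1}(matrix_sum_delta x); apply: le_trans (N_sum _) _.
apply: ler_sum => i _; apply: le_trans (N_sum _) _.
by apply: ler_sum => j _; rewrite NZ.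
Qed.

(** Real coordinates of a complex matrix, because the compactness argument below runs over real row
    vectors. *)
Let g (v : 'rV[R]_(n * n + n * n)) : 'M[C]_(n, n) := \matrix_(i, j)
  (v 0%R (lshift _ (mxvec_index i j)) +i* v 0%R (rshift _ (mxvec_index i j)))%C.

Let g_lin (a : R) v w : g (a *: v + w) = a%:C%C *: g v + g w.
Proof.
apply/matrixP => i j; rewrite !mxE.
by rewrite /GRing.add /GRing.mul /= !mul0r subr0 addr0.
Qed.

Let g_surj x : exists v, x = g v.
Proof.
exists (row_mx (mxvec (map_mx (@complex.Re R) x)) (mxvec (map_mx (@complex.Im R) x))).
by apply/matrixP => i j; rewrite mxE row_mxEl row_mxEr !mxvecE !mxE; case: (x i j).
Qed.

Let coord_le (v : 'rV[R]_(n * n + n * n)) k : `|v 0%R k| <= `|v|.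
Proof.
rewrite [X in _ <= X]mx_normrE.
by apply: (le_trans _ (@le_bigmax _ _ _ _ (fun i : 'I_1 * _ => `|v i.1 i.2|) (0, k))).
Qed.

Let entry_le v i j : normc (g v i j) <= 2 * `|v|.
Proof.
rewrite mxE; apply: le_trans (normc_le_abs _ _) _.
by rewrite mulr2n mulrDl mul1r; apply: lerD.
Qed.

Let L := 2 * \sum_(i < n) \sum_(j < n) N (delta_mx i j).
Let L0 : 0 <= L.
Proof. by rewrite mulr_ge0 // sumr_ge0 // => i _; rewrite sumr_ge0. Qed.

Let Ng_le v : N (g v) <= L * `|v|.
Proof.
apply: le_trans (N_le _) _; rewrite /L mulrAC mulr_sumr; apply: ler_sum => i _.
by rewrite mulr_sumr; apply: ler_sum => j _; rewrite ler_wpM2r.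
Qed.

Let gB v w : g (v - w) = g v - g w.
Proof. by rewrite addrC -scaleN1r g_lin rmorphN1 scaleN1r addrC. Qed.

Let Ng_lip v w : `|N (g v) - N (g w)| <= L * `|v - w|.
Proof.
apply: le_trans (Ng_le _); rewrite gB ler_norml; apply/andP; split.
  rewrite lerNl opprB lerBlDr -[N (g v - g w)]NN opprB -{1}[g w](subrK (g v)).
  exact: ND.
by rewrite lerBlDr -{1}[g v](subrK (g w)); exact: ND.
Qed.

Let Ng_cont : continuous (fun v => N (g v)).
Proof. exact: lipschitz_continuous L0 Ng_lip. Qed.

(** Half of the equivalence of norms: [N] composed with [g] is Lipschitz, hence has a positive
    minimum on the compact unit sphere. The witness is 2 over that minimum, the 2 coming from the
    real and imaginary parts of an entry. *)
Lemma entry_le_norm : exists K : R, 0 < K /\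
  forall (x : 'M[C]_(n, n)) i j, normc (x i j) <= K * N x.
Proof.
pose S : set 'rV[R]_(n * n + n * n) := [set v | `|v| = 1]%classic.
have nrm (v : 'rV[R]_(n * n + n * n)) : v != 0 -> S (`|v|^-1 *: v).
  by move=> v0; rewrite /S /= normrZ normfV normr_id mulVf // normr_eq0.
(* For [d = 0] the sphere is empty and every [v] is zero, so any positive [K] works. *)
have [S0|S0] := pselect (S !=set0)%classic; last first.
  exists 1; split=> // x i j; have [v ->] := g_surj x.
  have [->|v0] := eqVneq v 0; last by case: S0; exists (`|v|^-1 *: v); exact: nrm.
  by apply: le_trans (entry_le _ _ _) _; rewrite normr0 mulr0 mul1r.
have Sc : compact S.
  apply: bounded_closed_compact.
    exists 1; split=> // y y1 v /= ->; exact: ltW.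
  have -> : S = ((fun v : 'rV[R]_(n * n + n * n) => `|v|)
      @^-1` [set x | x = 1])%classic by [].
  by apply: closed_comp => // v _; exact: norm_continuous.
have [c Sc1 cmin] := EVT_min_rV S0 Sc (continuous_subspaceT Ng_cont).
move: Sc1; rewrite inE /S /= => c1.
have gc : 0 < N (g c).
  rewrite lt_def N_ge0 andbT; apply/eqP => /N_eq0 g0.
  have c0 : c = 0.
    apply/rowP => k; rewrite mxE; case: (split_ordP k) => [k' ->|k' ->];
    by case/mxvec_indexP: k' => i j; have /matrixP/(_ i j) := g0; rewrite !mxE => -[].
  by move: c1; rewrite c0 normr0 => /eqP; rewrite eq_sym oner_eq0.
exists (2 / N (g c)); split; first by rewrite divr_gt0.
move=> x i j; have [v ->] := g_surj x; apply: le_trans (entry_le _ _ _) _.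
have [->|v0] := eqVneq v 0; first by rewrite normr0 mulr0 !mulr_ge0 // invr_ge0 ltW.
rewrite -mulrA ler_pM2l // mulrC ler_pdivlMr //.
have vE : g v = `|v|%:C%C *: g (`|v|^-1 *: v).
  rewrite -[RHS]addr0 -[X in _ + X](_ : g 0 = 0); last first.
    by apply/matrixP => a b; rewrite !mxE.
  by rewrite -g_lin addr0 scalerA mulfV ?scale1r ?normr_eq0.
rewrite [in N (g v)]vE NZ /= expr0n /= addr0 sqrtr_sqr normr_id ler_wpM2l //.
by apply: cmin; rewrite inE; exact: nrm.
Qed.

End NormEquivalence.

(** * Bilinear forms on a separable algebra *)

Section Bilinear.
Variables (C : numFieldType) (d : nat).
Local Notation M := 'M[C]_d.

Definition bilin (q : M -> M -> C) : Prop :=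
  (forall a x x' y, q (a *: x + x') y = a * q x y + q x' y) /\
  (forall a x y y', q x (a *: y + y') = a * q x y + q x y').

Section BilinTheory.
Variable q : M -> M -> C.
Hypothesis qb : bilin q.

Lemma bilinDl x x' y : q (x + x') y = q x y + q x' y.
Proof. by rewrite -[x]scale1r qb.1 mul1r scale1r. Qed.
Lemma bilinDr x y y' : q x (y + y') = q x y + q x y'.
Proof. by rewrite -[y]scale1r qb.2 mul1r scale1r. Qed.
Lemma bilin0l y : q 0 y = 0.
Proof. by apply: (addIr (q 0 y)); rewrite -bilinDl addr0 add0r. Qed.
Lemma bilin0r x : q x 0 = 0.
Proof. by apply: (addIr (q x 0)); rewrite -bilinDr addr0 add0r. Qed.
Lemma bilinZl a x y : q (a *: x) y = a * q x y.
Proof. by rewrite -[a *: x]addr0 qb.1 bilin0l addr0. Qed.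
Lemma bilinZr a x y : q x (a *: y) = a * q x y.
Proof. by rewrite -[a *: y]addr0 qb.2 bilin0r addr0. Qed.
Lemma bilin_suml (I : finType) (F : I -> M) y :
  q (\sum_i F i) y = \sum_i q (F i) y.
Proof. by apply: (big_morph (q^~ y)) => [u v|]; rewrite ?bilinDl ?bilin0l. Qed.
Lemma bilin_sumr (I : finType) (F : I -> M) x :
  q x (\sum_i F i) = \sum_i q x (F i).
Proof. by apply: (big_morph (q x)) => [u v|]; rewrite ?bilinDr ?bilin0r. Qed.

End BilinTheory.

Lemma bilin_swap q : bilin q -> bilin (fun x y => q y x).
Proof. by case=> ql qr; split=> *; rewrite ?ql ?qr. Qed.

End Bilinear.

(** * Cyclic cochains on a separable algebra *)

Section Cyclic.
Variables (C : numFieldType) (d : nat).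
Local Notation M := 'M[C]_d.
Variable B : M -> Prop.
Hypothesis BM : forall x y, B x -> B y -> B (x *m y).
Hypothesis B1 : B 1%:M.
Variables (I : finType) (e f : I -> M).
Hypothesis Be : forall i, B (e i).
Hypothesis Bf : forall i, B (f i).
(** The tensor of the [e i] and [f i] is a symmetric separability idempotent of [B]; testing it
    against bilinear forms avoids tensor products. *)
Hypothesis casS : forall q : M -> M -> C, bilin q ->
  \sum_i q (e i) (f i) = \sum_i q (f i) (e i).
Hypothesis casC : forall (q : M -> M -> C) z, bilin q -> B z ->
  \sum_i q (z *m e i) (f i) = \sum_i q (e i) (f i *m z).
Hypothesis cas1 : \sum_i e i *m f i = 1%:M.

Lemma casC' (q : M -> M -> C) z : bilin q -> B z ->
  \sum_i q (e i *m z) (f i) = \sum_i q (e i) (z *m f i).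
Proof.
move=> qb Bz.
have b1 : bilin (fun x y => q (x *m z) y).
  by split=> *; first rewrite mulmxDl -scalemxAl qb.1; rewrite ?qb.2.
have b2 : bilin (fun x y => q x (z *m y)).
  by split=> *; last rewrite mulmxDr -scalemxAr qb.2; rewrite ?qb.1.
by rewrite (casS b1) -(casC (bilin_swap qb) Bz) -(casS b2).
Qed.

Variable n : M -> M -> C.
Hypothesis nb : bilin n.
Hypothesis nC : forall x y, B x -> B y -> n x y = - n y x.
Hypothesis n1 : forall x, B x -> n x 1%:M = 0.

(** For antisymmetric [n] this is its Hochschild coboundary, which is why it satisfies the cocycle
    identity below. *)
Let c x y z := n (x *m y) z + n (y *m z) x + n (z *m x) y.
Hypothesis cC : forall x y z, B x -> B y -> B z -> c x y z = - c y x z.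

Let scalL a (x y : M) : (a *: x) *m y = a *: (x *m y).
Proof. by rewrite scalemxAl. Qed.
Let scalR a (x y : M) : x *m (a *: y) = a *: (x *m y).
Proof. by rewrite scalemxAr. Qed.
Let expand := (@mulmxDl, @mulmxDr, scalL, scalR, bilinDl nb, bilinDr nb,
  bilinZl nb, bilinZr nb).

Local Ltac bil := split=> *; rewrite /c ?mulmxA ?expand; ring.
Local Ltac inB := by do ?[apply: BM | assumption | apply: Be | apply: Bf | apply: B1].

Let c23b x : bilin (fun y z => c x y z). Proof. by bil. Qed.

Let c_cyc x y z : c x y z = c y z x. Proof. by rewrite /c; ring. Qed.
Let c_swap23 x y z : B x -> B y -> B z -> c x y z = - c x z y.
Proof. by move=> Bx By Bz; rewrite c_cyc cC // -c_cyc. Qed.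

Let cocycle x y z w : B x -> B y -> B z -> B w ->
  c (x *m y) z w - c x (y *m z) w + c x y (z *m w) - c (w *m x) y z = 0.
Proof.
move=> Bx By Bz Bw.
have e1 := nC (BM Bz Bw) (BM Bx By); have e2 := nC (BM Bw Bx) (BM By Bz).
by rewrite /c; move: e1 e2; rewrite !mulmxA => -> ->; ring.
Qed.

(** The contracting homotopy of a separable algebra: inserting the Casimir tensor into the last two
    slots of [c] yields a primitive of [c], as [c_eq] shows. *)
Let k a z := \sum_i c a (z *m e i) (f i).

Let k_e_z a z : B a -> B z -> \sum_i c a (e i *m z) (f i) = - k a z.
Proof.
move=> Ba Bz; rewrite (casC' (c23b a) Bz).
rewrite (casS (q := fun x y => c a x (z *m y))); last by bil.
rewrite /k -sumrN; apply: eq_bigr => i _; apply: c_swap23; inB.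
Qed.

Let c_eq x y z : B x -> B y -> B z ->
  c x y z = k x (y *m z) + k y (z *m x) - k (x *m y) z.
Proof.
move=> Bx By Bz.
(* The cocycle identity with [f i] as fourth argument, to be summed once [z] is written as the sum
   of the [z *m e i *m f i]. *)
have coc i : c x y (z *m e i *m f i) =
   c x (y *m (z *m e i)) (f i) - c (x *m y) (z *m e i) (f i)
   + c (f i *m x) y (z *m e i).
  have := @cocycle x y (z *m e i) (f i).
  move=> /(_ Bx By (BM Bz (Be i)) (Bf i)) /eqP.
  by rewrite subr_eq0 => /eqP <-; ring.
have -> : c x y z = \sum_i c x y (z *m e i *m f i).
  rewrite -(bilin_sumr (c23b x)); congr (c x y).
  by under eq_bigr do rewrite -mulmxA; rewrite -mulmx_sumr cas1 mulmx1.
under eq_bigr do rewrite coc mulmxA.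
rewrite big_split sumrB /= -/(k x (y *m z)) -/(k (x *m y) z).
suff -> : \sum_i c (f i *m x) y (z *m e i) = k y (z *m x) by ring.
rewrite (casC (q := fun u v => c (v *m x) y u)) //; last by bil.
under eq_bigr do rewrite -mulmxA.
rewrite (casS (q := fun u v => c (v *m (z *m x)) y u)); last by bil.
rewrite -[k y _]opprK -k_e_z //; last by inB.
rewrite -sumrN; apply: eq_bigr => i _; apply: cC; inB.
Qed.

(** In the cocycle identity at [x *m e i], [y], [f i], [z] two terms cancel, because [y] moves
    across the Casimir tensor. The other two are the two sides, up to sign. *)
Let k_comm y x z : B x -> B y -> B z -> k y (x *m z) = k y (z *m x).
Proof.
move=> Bx By Bz.
have coc i : c (x *m e i) y (f i *m z) =
   c (x *m (e i)) (y *m f i) z - c (x *m (e i *m y)) (f i) z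
   + c (z *m x *m e i) y (f i).
  have := @cocycle (x *m e i) y (f i) z.
  move=> /(_ (BM Bx (Be i)) By (Bf i) Bz) /eqP.
  by rewrite subr_eq0 !mulmxA => /eqP <-; ring.
have : \sum_i c (x *m e i) y (f i *m z) = \sum_i c (z *m x *m e i) y (f i).
  under eq_bigr do rewrite coc.
  rewrite big_split sumrB /=.
  rewrite (casC' (q := fun u v => c (x *m u) v z)) //; last by bil.
  by rewrite subrr add0r.
rewrite -(casC (q := fun u v => c (x *m u) y v)) //; last by bil.
under eq_bigr do rewrite mulmxA.
have swp a : B a -> \sum_i c (a *m e i) y (f i) = - k y a.
  move=> Ba; rewrite /k -sumrN; apply: eq_bigr => i _; apply: cC; inB.
by rewrite (swp _ (BM Bx Bz)) (swp _ (BM Bz Bx)) => /oppr_inj.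
Qed.

Let k1 a : B a -> k a 1%:M = 0.
Proof.
move=> Ba; have e1 := k_e_z Ba B1; apply/eqP.
have e0 : \sum_i c a (e i *m 1%:M) (f i) = k a 1%:M.
  by apply: eq_bigr => i _; rewrite mulmx1 mul1mx.
by move/eqP: e1; rewrite e0 -addr_eq0 -mulr2n mulrn_eq0.
Qed.

Let k_anti x y : B x -> B y -> k x y = - k y x.
Proof.
(* At [z = 1] the cochain [c] reduces to [n y x + n x y], which vanishes. *)
move=> Bx By; have := c_eq Bx By B1.
rewrite k1; last by inB.
rewrite /c !mulmx1 !mul1mx n1; last by inB.
rewrite (nC By Bx) subr0 add0r addNr => /esym /eqP.
by rewrite addr_eq0 => /eqP.
Qed.

(* Writing [c] through [k], which is antisymmetric and blind to commutators,
   shows that [c] is symmetric as well as alternating. *)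
Lemma cyclic_cocycle0 x y z : B x -> B y -> B z -> c x y z = 0.
Proof.
move=> Bx By Bz; have e1 := c_eq Bx By Bz; have e2 := c_eq By Bx Bz.
have e3 := cC Bx By Bz.
have e4 : k (x *m y) z = k (y *m x) z.
  by rewrite (k_anti (BM Bx By) Bz) (k_comm Bx Bz By) -(k_anti (BM By Bx) Bz).
have e5 : c x y z = c y x z.
  by rewrite e1 e2 e4 (k_comm Bx By Bz) (k_comm Bz Bx By); ring.
by apply/eqP; move/eqP: e3; rewrite -e5 -addr_eq0 -mulr2n mulrn_eq0.
Qed.

(** In the sum over [i] of the vanishing [c x (y *m e i) (f i)], the middle term is [- n x y], and
    the outer ones depend only on [x *m y] and on [y *m x]. *)
Lemma antisym_factor : exists h g : M -> C,
  [/\ (forall a x y, h (a *: x + y) = a * h x + h y),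
      (forall a x y, g (a *: x + y) = a * g x + g y)
    & forall x y, B x -> B y -> n x y = h (x *m y) + g (y *m x)].
Proof.
exists (fun a => \sum_i n (a *m e i) (f i)).
exists (fun a => \sum_i n (f i *m a) (e i)).
split=> [a x y|a x y|x y Bx By].
- rewrite mulr_sumr -big_split; apply: eq_bigr => i _ /=.
  by rewrite !expand.
- rewrite mulr_sumr -big_split; apply: eq_bigr => i _ /=.
  by rewrite !expand.
have c0 i := @cyclic_cocycle0 x (y *m e i) (f i) Bx (BM By (Be i)) (Bf i).
have : \sum_i c x (y *m e i) (f i) = 0 by apply: big1 => i _; exact: c0.
rewrite /c !big_split /=.
have -> : \sum_i n (y *m e i *m f i) x = - n x y.
  rewrite -(bilin_suml nb).
  under eq_bigr do rewrite -mulmxA.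
  by rewrite -mulmx_sumr cas1 mulmx1 (nC By Bx).
rewrite (casC (q := fun u v => n (v *m x) u)) //; last by bil.
under eq_bigr do rewrite mulmxA.
under [X in _ + _ + X = 0]eq_bigr do rewrite -mulmxA.
by move/eqP; rewrite addrAC subr_eq0 => /eqP <-.
Qed.

End Cyclic.

(** * Polarization of identities known on selfadjoint elements *)

Section Polarization.
Variables (C : numClosedFieldType) (d : nat).
Local Notation M := 'M[C]_d.
Variable B : M -> Prop.
Hypothesis BD : forall x y, B x -> B y -> B (x + y).
Hypothesis BZ : forall a x, B x -> B (a *: x).
Hypothesis BM : forall x y, B x -> B y -> B (x *m y).
Hypothesis B1 : B 1%:M.
Hypothesis BT : forall x, B x -> B (x ^t*).

Definition selfadj (x : M) : Prop := B x /\ x ^t* = x.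

Lemma adjD m n (x y : 'M[C]_(m, n)) : (x + y) ^t* = x ^t* + y ^t*.
Proof. by rewrite linearD /= map_mxD. Qed.
Lemma adjZ m n a (x : 'M[C]_(m, n)) : (a *: x) ^t* = a^* *: x ^t*.
Proof. by rewrite linearZ /= map_mxZ. Qed.
Lemma adjB m n (x y : 'M[C]_(m, n)) : (x - y) ^t* = x ^t* - y ^t*.
Proof. by rewrite linearB /= map_mxB. Qed.
Lemma adjM m n p (x : 'M[C]_(m, n)) (y : 'M[C]_(n, p)) :
  (x *m y) ^t* = y ^t* *m x ^t*.
Proof. by rewrite trmx_mul map_mxM. Qed.
Lemma commutator_square n (V X : 'M[C]_n) :
  (X *m V - V *m X) ^t* *m (X *m V - V *m X) =
  V ^t* *m (X ^t* *m X) *m V - V ^t* *m X ^t* *m V *m X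
  - X ^t* *m (V ^t* *m X *m V) + X ^t* *m (V ^t* *m V) *m X.
Proof.
rewrite adjB !adjM mulmxBl !mulmxBr !mulmxA.
by rewrite opprB addrA addrAC -!addrA.
Qed.
Lemma adj1 n : (1%:M : 'M[C]_n) ^t* = 1%:M.
Proof. by rewrite tr_scalar_mx map_scalar_mx rmorph1. Qed.

Lemma selfadjD x y : selfadj x -> selfadj y -> selfadj (x + y).
Proof. by move=> [Bx hx] [By hy]; split; rewrite ?adjD ?hx ?hy //; exact: BD. Qed.

Lemma selfadj_decomp x : B x ->
  exists x1 x2, [/\ selfadj x1, selfadj x2 & x = x1 + 'i *: x2].
Proof.
move=> Bx; have Bt := BT Bx.
exists (2^-1 *: (x + x ^t*)), ((- 'i * 2^-1) *: (x - x ^t*)).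
have c2 : (2^-1 : C)^* = 2^-1 by rewrite conj_Creal // realV realn.
have ii : 'i * 'i = -1 :> C by rewrite -expr2 sqrCi.
split.
- split; first by apply: BZ; apply: BD.
  by rewrite adjZ adjD trmxCK c2 [X in _ *: X]addrC.
- split; first by apply: BZ; apply: BD => //; rewrite -scaleN1r; apply: BZ.
  rewrite adjZ -scaleN1r adjD adjZ trmxCK rmorphN rmorph1 rmorphM rmorphN /=.
  rewrite conjCi c2 opprK !scaleN1r -[x ^t* - x]opprB scalerN -scaleNr.
  by rewrite mulNr.
rewrite scalerA mulrA mulrN ii opprK mul1r -scalerDr addrACA subrr addr0.
by rewrite -mulr2n -scalerMnr -scaler_nat scalerA mulfV ?scale1r // pnatr_eq0.
Qed.

(** Reduces multilinear identities on [B] to selfadjoint arguments, where the spectral theorem is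
    available. *)
Lemma linear_selfadj_eq0 (q : M -> C) :
  (forall a x y, q (a *: x + y) = a * q x + q y) ->
  (forall x, selfadj x -> q x = 0) -> forall x, B x -> q x = 0.
Proof.
move=> ql q0 x /selfadj_decomp [x1 [x2 [h1 h2 ->]]].
by rewrite addrC ql !q0 // mulr0 addr0.
Qed.

Variable m : M -> M -> C.
Hypothesis mb : bilin m.
Hypothesis m2 : forall h, selfadj h -> m h h = m (h *m h) 1%:M.
Hypothesis m3 : forall h, selfadj h -> m (h *m h) h = m (h *m h *m h) 1%:M.

(** Polarizing [m2] shows that the subtracted term is the symmetric part of [m] on [B], so that [n]
    is the antisymmetric part. *)
Let n x y := m x y - 2^-1 * m (x *m y + y *m x) 1%:M.

Let scalL a (x y : M) : (a *: x) *m y = a *: (x *m y).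
Proof. by rewrite scalemxAl. Qed.
Let scalR a (x y : M) : x *m (a *: y) = a *: (x *m y).
Proof. by rewrite scalemxAr. Qed.
Let mexpand := (@mulmxDl, @mulmxDr, scalL, scalR, bilinDl mb, bilinDr mb,
  bilinZl mb, bilinZr mb).

Lemma antisym_bilin : bilin n.
Proof. by split=> *; rewrite /n !mexpand; ring. Qed.

Let nexpand := (@mulmxDl, @mulmxDr, scalL, scalR, bilinDl antisym_bilin,
  bilinDr antisym_bilin, bilinZl antisym_bilin, bilinZr antisym_bilin).

Lemma antisym1 x : B x -> n x 1%:M = 0.
Proof.
by move=> Bx; rewrite /n mulmx1 mul1mx mexpand; field.
Qed.

Lemma antisymC x y : B x -> B y -> n x y = - n y x.
Proof.
move=> Bx By; apply/eqP; rewrite -addr_eq0; apply/eqP; move: x Bx.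
apply: linear_selfadj_eq0 => [a x z|x hx]; first by rewrite !nexpand; ring.
move: y By; apply: linear_selfadj_eq0 => [a y z|y hy].
  by rewrite !nexpand; ring.
pose q h := m h h - m (h *m h) 1%:M.
have q0 h : selfadj h -> q h = 0 by move=> /m2 e; rewrite /q e subrr.
transitivity (q (x + y) - q x - q y).
  by rewrite /q /n !mexpand; field.
by rewrite !q0 ?subr0 //; exact: selfadjD.
Qed.

Let c x y z := n (x *m y) z + n (y *m z) x + n (z *m x) y.

Let n3 h : selfadj h -> n (h *m h) h = 0.
Proof. by move=> hh; rewrite /n m3 // !mexpand !mulmxA; field. Qed.

Let c_sym0 x y z : B x -> B y -> B z -> c x y z + c y x z = 0.
Proof.
move=> Bx By Bz; move: x Bx.
apply: linear_selfadj_eq0 => [a x x'|x hx]; first by rewrite /c !nexpand; ring.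
move: y By; apply: linear_selfadj_eq0 => [a y y'|y hy].
  by rewrite /c !nexpand; ring.
move: z Bz; apply: linear_selfadj_eq0 => [a z z'|z hz].
  by rewrite /c !nexpand; ring.
(* The full polarization of this cubic form, by inclusion and exclusion, is [c x y z + c y x z];
   [m3] makes the form vanish. *)
pose q h := n (h *m h) h.
transitivity (q (x + y + z) - q (x + y) - q (y + z) - q (x + z)
  + q x + q y + q z).
  by rewrite /q /c !nexpand; ring.
by rewrite /q !n3 ?subr0 ?addr0 //; do ?apply: selfadjD.
Qed.

Variables (I : finType) (e f : I -> M).
Hypothesis Be : forall i, B (e i).
Hypothesis Bf : forall i, B (f i).
Hypothesis casS : forall q : M -> M -> C, bilin q ->
  \sum_i q (e i) (f i) = \sum_i q (f i) (e i).
Hypothesis casC : forall (q : M -> M -> C) z, bilin q -> B z ->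
  \sum_i q (z *m e i) (f i) = \sum_i q (e i) (f i *m z).
Hypothesis cas1 : \sum_i e i *m f i = 1%:M.

Lemma bilin_factor : exists h g : M -> C,
  [/\ (forall a x y, h (a *: x + y) = a * h x + h y),
      (forall a x y, g (a *: x + y) = a * g x + g y)
    & forall x y, B x -> B y -> m x y = h (x *m y) + g (y *m x)].
Proof.
have cC x y z : B x -> B y -> B z -> c x y z = - c y x z.
  by move=> Bx By Bz; apply/eqP; rewrite -addr_eq0 c_sym0.
have [h [g [hl gl E]]] := antisym_factor BM B1 Be Bf casS casC cas1
  antisym_bilin antisymC antisym1 cC.
exists (fun x => h x + 2^-1 * m x 1%:M), (fun x => g x + 2^-1 * m x 1%:M).
split=> [a x y|a x y|x y Bx By].
- by rewrite hl !mexpand; ring.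
- by rewrite gl !mexpand; ring.
by rewrite addrACA -E // /n !mexpand; ring.
Qed.

End Polarization.

(** * Functional calculus in the commutant *)

Section Commutant.
Variables (C : numClosedFieldType) (d : nat).
Local Notation M := 'M[C]_d.
Variable A : {pred M}.

Definition commutant (x : M) : Prop := forall a, a \in A -> x *m a = a *m x.

Lemma commutantD x y : commutant x -> commutant y -> commutant (x + y).
Proof. by move=> Bx By a Aa; rewrite mulmxDl mulmxDr Bx ?By. Qed.
Lemma commutantZ t x : commutant x -> commutant (t *: x).
Proof. by move=> Bx a Aa; rewrite -scalemxAl -scalemxAr Bx. Qed.
Lemma commutantM x y : commutant x -> commutant y -> commutant (x *m y).
Proof. by move=> Bx By a Aa; rewrite -mulmxA By // !mulmxA Bx. Qed.
Lemma commutant1 : commutant 1%:M.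
Proof. by move=> a Aa; rewrite mulmx1 mul1mx. Qed.
Lemma commutantV x : commutant x -> commutant (invmx x).
Proof.
move=> Bx a Aa; have [ux|nux] := boolP (x \in unitmx); last first.
  by rewrite (invmx_out nux) Bx.
by rewrite -{1}[a](mulmxK ux) -Bx // -mulmxA mulKmx.
Qed.
Lemma commutantT (AT : forall a, a \in A -> a ^t* \in A) x :
  commutant x -> commutant (x ^t*).
Proof. by move=> Bx a Aa; rewrite -[a]trmxCK -!adjM Bx ?AT. Qed.

Definition unitary_in (u : M) : Prop := commutant u /\ u \is unitarymx.

Lemma unitary_adjM n (u : 'M[C]_n) : u \is unitarymx -> u ^t* *m u = 1%:M.
Proof. by rewrite -trmxC_unitary => /unitarymxP; rewrite trmxCK. Qed.

Lemma unitary_in1 : unitary_in 1%:M.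
Proof.
split; first exact: commutant1.
by apply/unitarymxP; rewrite adj1 mulmx1.
Qed.

Lemma unitary_inT (AT : forall a, a \in A -> a ^t* \in A) u :
  unitary_in u -> unitary_in (u ^t*).
Proof.
move=> [Bu uu]; split; last by rewrite trmxC_unitary.
exact: commutantT.
Qed.

Lemma unitary_inM u v : unitary_in u -> unitary_in v -> unitary_in (u *m v).
Proof.
by move=> [Bu uu] [Bv uv]; split; [exact: commutantM | exact: mul_unitarymx].
Qed.

Lemma sum_adj_closed (V : nmodType) (F : M -> V) (s : seq M) :
  let t := 1%:M :: s ++ [seq u ^t* | u <- s] in
  \sum_(u <- t) F (u ^t*) = \sum_(u <- t) F u.
Proof.
rewrite /= !big_cons !big_cat !big_map adj1 /= [X in _ + X = _]addrC.
by under eq_bigr do rewrite trmxCK.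
Qed.

Lemma reflection_unitary n (p : 'M[C]_n) : p ^t* = p -> p *m p = p ->
  1%:M - 2 *: p \is unitarymx.
Proof.
move=> pt pp; apply/unitarymxP; rewrite adjB adjZ adj1 pt rmorph_nat.
rewrite mulmxBl !mulmxBr !mul1mx mulmx1 -!scalemxAl -!scalemxAr pp scalerA.
by apply/matrixP => i j; rewrite !mxE; ring.
Qed.

Lemma diag_mxM n (u v : 'rV[C]_n) :
  diag_mx u *m diag_mx v = diag_mx (\row_j (u 0 j * v 0 j)).
Proof. by rewrite mulmx_diag; congr diag_mx; apply/rowP => j; rewrite !mxE. Qed.

Section FunctionalCalculus.
Variable h : M.
Hypothesis hh : h ^t* = h.
Let P := spectralmx h.
Let l := spectral_diag h.

Definition fcalc (phi : C -> C) : M := P ^t* *m diag_mx (map_mx phi l) *m P.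

Let Pu : P \is unitarymx. Proof. exact: spectral_unitarymx. Qed.
Let PPt : P *m P ^t* = 1%:M. Proof. exact/unitarymxP. Qed.
Let PtP : P ^t* *m P = 1%:M.
Proof. by rewrite -{2}[P]trmxCK; apply/unitarymxP; rewrite trmxC_unitary. Qed.

Lemma fcalc_id : fcalc id = h.
Proof.
have hn : h \is normalmx by apply/normalmxP; rewrite hh.
rewrite [RHS](orthomx_spectralP hn) invmx_unitary //.
by congr (_ *m diag_mx _ *m _); apply/rowP => j; rewrite mxE.
Qed.

Lemma fcalcM phi psi : fcalc phi *m fcalc psi = fcalc (fun x => phi x * psi x).
Proof.
rewrite /fcalc !mulmxA -[_ *m P *m P ^t*]mulmxA PPt mulmx1.
rewrite -[P ^t* *m _ *m _]mulmxA diag_mxM.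
by congr (_ *m diag_mx _ *m _); apply/rowP => j; rewrite !mxE.
Qed.

Lemma fcalc_adj phi : (fcalc phi) ^t* = fcalc (fun x => (phi x)^*).
Proof.
rewrite /fcalc !adjM trmxCK mulmxA tr_diag_mx map_diag_mx.
by congr (_ *m diag_mx _ *m _); apply/rowP => j; rewrite !mxE.
Qed.

Lemma fcalc_sum (s : seq C) (F : C -> C -> C) :
  fcalc (fun x => \sum_(t <- s) F t x) = \sum_(t <- s) fcalc (F t).
Proof.
elim: s => [|t s IH].
  rewrite big_nil /fcalc (_ : map_mx _ l = 0) ?linear0 ?mulmx0 ?mul0mx //.
  by apply/rowP => j; rewrite !mxE big_nil.
rewrite big_cons -IH /fcalc -mulmxDl -mulmxDr -linearD /=.
by congr (_ *m diag_mx _ *m _); apply/rowP => j; rewrite !mxE big_cons.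
Qed.

Lemma fcalcZ a phi : fcalc (fun x => a * phi x) = a *: fcalc phi.
Proof.
rewrite /fcalc scalemxAl scalemxAr -linearZ /=.
by congr (_ *m diag_mx _ *m _); apply/rowP => j; rewrite !mxE.
Qed.

Lemma eq_fcalc phi psi : (forall j, phi (l 0 j) = psi (l 0 j)) ->
  fcalc phi = fcalc psi.
Proof.
by move=> e; congr (_ *m diag_mx _ *m _); apply/rowP => j; rewrite !mxE e.
Qed.

(** The sum runs over distinct eigenvalues: those projections are functions of [h] and commute with
    all that [h] commutes with, unlike projections on single eigenvectors. *)
Lemma fcalc_decomp phi : fcalc phi =
  \sum_(t <- undup (codom (l 0))) phi t *: fcalc (fun x => (x == t)%:R).
Proof.
under eq_bigr do rewrite -fcalcZ.
rewrite -fcalc_sum; apply: eq_fcalc => j.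
rewrite (bigD1_seq (l 0 j)) ?mem_undup ?codom_f ?undup_uniq //=.
rewrite eqxx mulr1 big1 ?addr0 // => t; rewrite eq_sym => /negPf ->.
by rewrite mulr0.
Qed.

(** In the eigenbasis of [h], a nonzero entry of a matrix commuting with [h] joins two equal
    eigenvalues, and [phi] takes equal values there; hence [phi] is arbitrary. *)
Lemma fcalc_commutant phi : commutant h -> commutant (fcalc phi).
Proof.
move=> Bh a Aa; pose a' := P *m a *m P ^t*.
have ea : a = P ^t* *m a' *m P.
  by rewrite /a' !mulmxA PtP mul1mx -mulmxA PtP mulmx1.
clearbody a'; have comm : diag_mx l *m a' = a' *m diag_mx l.
  have := Bh a Aa; rewrite -fcalc_id /fcalc (_ : map_mx id l = l) ?{1 2}ea; last first.
    by apply/rowP => j; rewrite mxE.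
  rewrite !mulmxA -![_ *m P *m P ^t*]mulmxA PPt !mulmx1.
  move/(congr1 (fun x => P *m x *m P ^t*)).
  by rewrite !mulmxA PPt !mul1mx -![_ *m P *m P ^t*]mulmxA PPt !mulmx1.
have commphi : diag_mx (map_mx phi l) *m a' = a' *m diag_mx (map_mx phi l).
  apply/matrixP => i j; have /matrixP/(_ i j) := comm.
  rewrite !mul_diag_mx !mul_mx_diag !mxE mulrC => /eqP.
  rewrite -subr_eq0 -mulrBr mulf_eq0 => /orP[/eqP ->|].
    by rewrite mulr0 mul0r.
  by rewrite subr_eq0 => /eqP ->; rewrite mulrC.
rewrite {1 2}ea /fcalc !mulmxA -![_ *m P *m P ^t*]mulmxA PPt !mulmx1.
by rewrite -[X in X *m P = _]mulmxA commphi mulmxA.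
Qed.

End FunctionalCalculus.

Variable m : M -> M -> C.
Hypothesis mb : bilin m.
Hypothesis mU : forall u, commutant u -> u \is unitarymx -> m (u ^t*) u = 0.

Let m11 : m 1%:M 1%:M = 0.
Proof.
have := mU commutant1; rewrite adj1; apply.
by apply/unitarymxP; rewrite adj1 mulmx1.
Qed.

Definition proj_in (p : M) := [/\ commutant p, p ^t* = p & p *m p = p].

(** The conditions say that [1 + a] and [1 + b] have modulus one, which makes the matrix unitary.
    The phases used below are -1 and ['i]. *)
Let two_proj p q a b : proj_in p -> proj_in q -> p *m q = 0 -> q *m p = 0 ->
  a + a^* + a * a^* = 0 -> b + b^* + b * b^* = 0 ->
  m (1%:M + a^* *: p + b^* *: q) (1%:M + a *: p + b *: q) = 0.
Proof.
move=> [Bp hp pp] [Bq hq qq] pq qp ea eb.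
pose u : M := 1%:M + a *: p + b *: q.
have ut : u ^t* = 1%:M + a^* *: p + b^* *: q.
  by rewrite !adjD !adjZ adj1 hp hq.
rewrite -ut; apply: mU.
  by do ?apply: commutantD; do ?apply: commutantZ => //; exact: commutant1.
apply/unitarymxP; rewrite ut /u !mulmxDl !mulmxDr !mul1mx !mulmx1.
rewrite -!scalemxAl -!scalemxAr pp qq pq qp.
have eab x y : (a + a^* + a * a^*) * x + (b + b^* + b * b^*) * y = 0.
  by rewrite ea eb !mul0r addr0.
apply/matrixP => i j; rewrite !mxE -[RHS]addr0 -[X in _ = _ + X](eab (p i j) (q i j)).
by ring.
Qed.

Let ii : 'i * 'i = -1 :> C. Proof. by rewrite -expr2 sqrCi. Qed.

Let cond2 : (-2 : C) + (-2)^* + (-2) * (-2)^* = 0.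
Proof. by rewrite rmorphN rmorph_nat; ring. Qed.

Let conji : ('i - 1 : C)^* = - 'i - 1.
Proof. by rewrite rmorphB rmorph1 /= conjCi. Qed.

Let condi : ('i - 1 : C) + ('i - 1)^* + ('i - 1) * ('i - 1)^* = 0.
Proof.
rewrite conji; transitivity (- ('i * 'i) - 1 : C); first by ring.
by rewrite ii; ring.
Qed.

Let proj0 : proj_in 0.
Proof.
split; rewrite ?mulmx0 ?linear0 ?map_mx0 //.
by move=> a _; rewrite mulmx0 mul0mx.
Qed.

Let mexpand := (bilinDl mb, bilinDr mb, bilinZl mb, bilinZr mb, bilin0l mb,
  bilin0r mb, m11).

Let i2_neq0 : 2 * 'i != 0 :> C.
Proof. by rewrite mulf_neq0 ?neq0Ci ?pnatr_eq0. Qed.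

Let normi : ('i - 1) * (- 'i - 1) = 2 :> C.
Proof. by transitivity (1 - 'i * 'i : C); [ring | rewrite ii; ring]. Qed.

(** The phases -1 and ['i] on [p] give two linear equations; eliminating [m p p] leaves a multiple
    of [m p 1 - m 1 p]. *)
Lemma proj_rel p : proj_in p -> m 1%:M p = m p 1%:M /\ m p p = m p 1%:M.
Proof.
move=> hp; have T := two_proj hp proj0 (mulmx0 _ _) (mul0mx _ _).
have := T _ _ condi condi; have := T _ _ cond2 cond2.
rewrite !scaler0 !addr0 !mexpand conji rmorphN rmorph_nat.
set x := m 1%:M p; set y := m p 1%:M; set z := m p p => T1 T2.
have E : x = y.
  apply/esym/eqP; rewrite -subr_eq0 -(mulrI_eq0 _ (mulfI i2_neq0)); apply/eqP.
  have -> : 0 = 0 - 2 * 0 :> C by rewrite mulr0 subr0.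
  rewrite -[X in _ = X - _]T1 -[X in _ - 2 * X]T2.
  transitivity (4 * z - 2 * (('i - 1) * (- 'i - 1)) * z + 2 * 'i * (y - x)).
    by rewrite normi; ring.
  by ring.
split=> //; move: T1; rewrite E => T1.
apply/eqP; rewrite -subr_eq0 -(mulrI_eq0 _ (mulfI (_ : 4 != 0 :> C))) ?pnatr_eq0 //.
by rewrite -T1; apply/eqP; ring.
Qed.

(** The phases -1, -1 yield only [m q p = - m p q]; replacing the first by ['i] breaks the symmetry
    and kills [m p q]. *)
Lemma proj_ortho_rel p q : proj_in p -> proj_in q -> p *m q = 0 -> q *m p = 0 ->
  m p q = 0.
Proof.
move=> hp hq pq qp; have T := two_proj hp hq pq qp.
have [P1 P2] := proj_rel hp; have [Q1 Q2] := proj_rel hq.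
have T1 := T _ _ cond2 cond2; have T2 := T _ _ condi cond2.
move: T1 T2; rewrite !mexpand conji rmorphN rmorph_nat P1 P2 Q1 Q2.
set x := m p q; set y := m q p; set u := m p 1%:M; set v := m q 1%:M => T1 T2.
have yx : y = - x.
  apply/eqP; rewrite -addr_eq0 -(mulrI_eq0 _ (mulfI (_ : 4 != 0 :> C))) ?pnatr_eq0 //.
  by rewrite -T1; apply/eqP; ring.
move: T2; rewrite yx => T2.
apply/eqP; rewrite -(mulrI_eq0 _ (mulfI i2_neq0)).
rewrite -(mulrI_eq0 _ (mulfI (_ : 2 != 0 :> C))) ?pnatr_eq0 //.
apply/eqP; rewrite -T2.
transitivity (2 * (2 * 'i * x) + (('i - 1) * (- 'i - 1) - 2) * u).
  by rewrite normi; ring.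
by ring.
Qed.

(** Two functions are allowed because both the quadratic and the cubic relation in [h] are
    wanted. *)
Lemma spectral_rel h (phi psi : C -> C) : selfadj commutant h ->
  m (fcalc h phi) (fcalc h psi) = m (fcalc h (fun x => phi x * psi x)) 1%:M.
Proof.
move=> [Bh hh]; pose s := undup (codom (spectral_diag h 0)).
pose p t := fcalc h (fun x => (x == t)%:R).
have su : uniq s by exact: undup_uniq.
have dec f : fcalc h f = \sum_(t <- s) f t *: p t by exact: fcalc_decomp.
have pM t t' : p t *m p t' = if t == t' then p t else 0.
  rewrite fcalcM; case: eqP => [<-|/eqP ne].
    by apply: eq_fcalc => j; rewrite -natrM mulnb andbb.
  rewrite -(scale0r (p t)) -fcalcZ; apply: eq_fcalc => j.
  by rewrite mul0r -natrM mulnb; case: eqP => // ->; rewrite (negPf ne).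
have pp t : proj_in (p t).
  split; last by rewrite pM eqxx.
    exact: fcalc_commutant.
  by rewrite fcalc_adj; apply: eq_fcalc => j; rewrite rmorph_nat.
have suml (F : C -> M) y : m (\sum_(t <- s) F t) y = \sum_(t <- s) m (F t) y.
  by apply: (big_morph (m^~ y)) => [a b|]; rewrite ?bilinDl ?bilin0l.
have sumr (F : C -> M) x : m x (\sum_(t <- s) F t) = \sum_(t <- s) m x (F t).
  by apply: (big_morph (m x)) => [a b|]; rewrite ?bilinDr ?bilin0r.
rewrite (dec phi) (dec psi) (dec (fun x => _)) !suml.
rewrite big_seq [RHS]big_seq; apply: eq_bigr => t ts.
rewrite sumr (bigD1_seq t) //= big1 => [|t' ne].
  by rewrite addr0 !mexpand (proj_rel (pp t)).2; ring.
rewrite !mexpand proj_ortho_rel ?mulr0 //; rewrite pM.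
  by rewrite eq_sym (negPf ne).
by rewrite (negPf ne).
Qed.

Lemma selfadj_rel h : selfadj commutant h ->
  m h h = m (h *m h) 1%:M /\ m (h *m h) h = m (h *m h *m h) 1%:M.
Proof.
move=> hh; have e := fcalc_id hh.2.
have := @spectral_rel h id id hh.
have := @spectral_rel h (fun x => x * x) id hh.
by rewrite -!fcalcM !e.
Qed.

End Commutant.

(** * The Casimir element of the commutant *)

Section HilbertSchmidt.
Variables (C : numClosedFieldType).

Lemma sum_mxvec (V : nmodType) m n (F : 'I_(m * n) -> V) :
  \sum_k F k = \sum_i \sum_j F (mxvec_index i j).
Proof.
rewrite pair_bigA /= (reindex _ (curry_mxvec_bij m n)) /=.
by apply: eq_bigr => [[i j]].
Qed.

Lemma tr_adj_mul m n (x y : 'M[C]_(m, n)) :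
  \tr (x ^t* *m y) = \sum_i \sum_j (x i j)^* * y i j.
Proof.
rewrite /mxtrace exchange_big; apply: eq_bigr => i _; rewrite !mxE.
by apply: eq_bigr => j _; rewrite !mxE.
Qed.

Lemma tr_adj_ge0 m n (x : 'M[C]_(m, n)) : 0 <= \tr (x ^t* *m x).
Proof.
rewrite tr_adj_mul; apply: sumr_ge0 => i _; apply: sumr_ge0 => j _.
by rewrite mulrC mul_conjC_ge0.
Qed.

Lemma tr_adj_eq0 m n (x : 'M[C]_(m, n)) : \tr (x ^t* *m x) = 0 -> x = 0.
Proof.
rewrite tr_adj_mul pair_bigA /= => e; apply/matrixP => i j; rewrite mxE.
have p0 (k : 'I_m * 'I_n) : true -> 0 <= (x k.1 k.2)^* * x k.1 k.2.
  by move=> _; rewrite mulrC mul_conjC_ge0.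
have /(_ (i, j) isT) /eqP := psumr_eq0P p0 e.
by rewrite mulrC mul_conjC_eq0 => /eqP.
Qed.

Lemma tr_adj_subZ m n l (x y : 'M[C]_(m, n)) :
  \tr ((y - l *: x) ^t* *m (y - l *: x)) = \tr (y ^t* *m y)
    - l * \tr (y ^t* *m x) - l^* * \tr (x ^t* *m y)
    + l * l^* * \tr (x ^t* *m x).
Proof.
rewrite -scaleNr adjD adjZ mulmxDl !mulmxDr !mxtraceD.
by rewrite -!scalemxAl -!scalemxAr !mxtraceZ rmorphN /=; ring.
Qed.

Lemma tr_conj m (x : 'M[C]_m) : (\tr x)^* = \tr (x ^t*).
Proof. by rewrite rmorph_sum; apply: eq_bigr => i _; rewrite !mxE. Qed.

Variable d : nat.
Local Notation M := 'M[C]_d.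
Variable B : M -> Prop.
Hypothesis BD : forall x y, B x -> B y -> B (x + y).
Hypothesis BZ : forall a x, B x -> B (a *: x).

Definition orthonormal_in r (b : 'I_r -> M) : Prop :=
  (forall i, B (b i)) /\ forall i j, \tr ((b i) ^t* *m b j) = (i == j)%:R.

Lemma orthonormal_size r (b : 'I_r -> M) : orthonormal_in b -> (r <= d * d)%N.
Proof.
move=> [_ on]; pose W := \matrix_i mxvec (b i).
suff /mxrank_unitary <- : W \is unitarymx by exact: rank_leq_col.
apply/unitarymxP/matrixP => i j; rewrite !mxE eq_sym -on tr_adj_mul sum_mxvec.
by apply: eq_bigr => k _; apply: eq_bigr => l _; rewrite !mxE !mxvecE mulrC.
Qed.

(** An orthonormal family of maximal size exists by [orthonormal_size]; a nonzero residual [y], once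
    normalised, would enlarge it. *)
Lemma orthonormal_basis : B 0 -> exists r (b : 'I_r -> M), orthonormal_in b /\
  forall x, B x -> x = \sum_i \tr ((b i) ^t* *m x) *: b i.
Proof.
move=> B0; pose P r := `[< exists b : 'I_r -> M, orthonormal_in b >].
have exP : exists r, P r.
  by exists 0; apply/asboolP; exists (fun=> 0); split=> [|[]].
have bd r : P r -> (r <= d * d)%N.
  by move=> /asboolP [b]; exact: orthonormal_size.
case: (ex_maxnP exP bd) => r /asboolP [b [Bb on]] rmax.
exists r, b; split=> // x Bx; pose y := x - \sum_i \tr ((b i) ^t* *m x) *: b i.
have By : B y.
  apply: BD => //; rewrite -scaleN1r; apply: BZ.
  by apply: (big_ind B) => // i _; exact: BZ.
have oy i : \tr ((b i) ^t* *m y) = 0.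
  rewrite mulmxBr linearB /= mulmx_sumr linear_sum /=.
  rewrite (bigD1 i) //= big1 => [|j /negPf ne].
    by rewrite addr0 -scalemxAr linearZ /= on eqxx mulr1 subrr.
  by rewrite -scalemxAr linearZ /= on eq_sym ne mulr0.
have [y0|y0] := eqVneq y 0; first by apply/eqP; rewrite -subr_eq0 -/y y0.
have oy' i : \tr (y ^t* *m b i) = 0.
  by apply: (can_inj (@conjCK C)); rewrite tr_conj adjM trmxCK oy conjC0.
pose t := sqrtC (\tr (y ^t* *m y)).
have tn : t ^+ 2 = \tr (y ^t* *m y) by rewrite sqrtCK.
have tr : t^* = t by rewrite conj_Creal // ger0_real // sqrtC_ge0 tr_adj_ge0.
have t0 : t != 0.
  rewrite sqrtC_eq0; apply: contra y0 => /eqP e; apply/eqP; exact: tr_adj_eq0.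
have : P r.+1.
  apply/asboolP; exists (fun i => oapp b (t^-1 *: y) (unlift ord_max i)).
  split=> [i|i j].
    by case: unliftP => [k _|_] //=; apply: BZ.
  case: unliftP => [k ->|->]; case: unliftP => [l ->|->] /=.
  - by rewrite on (inj_eq lift_inj).
  - by rewrite -scalemxAr linearZ /= oy mulr0 eq_sym (negPf (neq_lift _ _)).
  - by rewrite adjZ -scalemxAl linearZ /= oy' mulr0 (negPf (neq_lift _ _)).
  rewrite adjZ -scalemxAl -scalemxAr !linearZ /= -tn fmorphV /= tr eqxx.
  by rewrite expr2 mulKf // mulVf.
by move=> /rmax; rewrite ltnn.
Qed.

End HilbertSchmidt.

Section Casimir.
Variables (C : numClosedFieldType) (d : nat).
Local Notation M := 'M[C]_d.
Variable A : {pred M}.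
Hypothesis AT : forall a, a \in A -> a ^t* \in A.
Local Notation B := (commutant A).

(** The tensor of the [b i] and their adjoints, for an orthonormal basis [b] of the commutant, has
    the two exchange properties. Its product [c] is central and invertible, and dividing by [c]
    normalises it. *)
Lemma casimir : exists r (e f : 'I_r -> M),
  [/\ forall i, B (e i), forall i, B (f i),
      forall q : M -> M -> C, bilin q ->
        \sum_i q (e i) (f i) = \sum_i q (f i) (e i),
      forall (q : M -> M -> C) z, bilin q -> B z ->
        \sum_i q (z *m e i) (f i) = \sum_i q (e i) (f i *m z)
    & \sum_i e i *m f i = 1%:M].
Proof.
have B0 : B 0 by move=> a _; rewrite mulmx0 mul0mx.
have [r [b [[Bb on] gen]]] :=
  orthonormal_basis (@commutantD C d A) (@commutantZ C d A) B0.
have BT := commutantT AT.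
have trC (x y : M) : (\tr (x ^t* *m y))^* = \tr (y ^t* *m x).
  by rewrite tr_conj adjM trmxCK.
(* The commutant is closed under adjoints, so the adjoints of the [b i] expand in [b], with a
   coefficient matrix that is symmetric by cyclicity of the trace. *)
have S0 (q : M -> M -> C) : bilin q ->
    \sum_i q (b i) ((b i) ^t*) = \sum_i q ((b i) ^t*) (b i).
  move=> qb.
  have -> : \sum_i q (b i) ((b i) ^t*) =
      \sum_i \sum_j \tr ((b j) ^t* *m (b i) ^t*) * q (b i) (b j).
    apply: eq_bigr => i _; rewrite [in LHS](gen _ (BT _ (Bb i))) (bilin_sumr qb).
    by apply: eq_bigr => j _; rewrite (bilinZr qb).
  have -> : \sum_i q ((b i) ^t*) (b i) =
      \sum_i \sum_j \tr ((b j) ^t* *m (b i) ^t*) * q (b j) (b i).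
    apply: eq_bigr => i _; rewrite [in LHS](gen _ (BT _ (Bb i))) (bilin_suml qb).
    by apply: eq_bigr => j _; rewrite (bilinZl qb).
  rewrite [RHS]exchange_big; apply: eq_bigr => i _; apply: eq_bigr => j _.
  by rewrite mxtrace_mulC.
have C0 (q : M -> M -> C) z : bilin q -> B z ->
    \sum_i q (z *m b i) ((b i) ^t*) = \sum_i q (b i) ((b i) ^t* *m z).
  move=> qb Bz.
  have -> : \sum_i q (z *m b i) ((b i) ^t*) =
      \sum_i \sum_j \tr ((b j) ^t* *m (z *m b i)) * q (b j) ((b i) ^t*).
    apply: eq_bigr => i _.
    rewrite [in LHS](gen _ (commutantM Bz (Bb i))) (bilin_suml qb).
    by apply: eq_bigr => j _; rewrite (bilinZl qb).
  have -> : \sum_i q (b i) ((b i) ^t* *m z) =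
      \sum_i \sum_j \tr ((b i) ^t* *m (z *m b j)) * q (b i) ((b j) ^t*).
    apply: eq_bigr => i _.
    have -> : (b i) ^t* *m z = (z ^t* *m b i) ^t* by rewrite adjM trmxCK.
    rewrite [in LHS](gen _ (commutantM (BT _ Bz) (Bb i))).
    rewrite (_ : (\sum_j _) ^t* =
        \sum_j \tr ((b i) ^t* *m (z *m b j)) *: (b j) ^t*).
      by rewrite (bilin_sumr qb); apply: eq_bigr => j _; rewrite (bilinZr qb).
    rewrite (big_morph (fun x : M => x ^t*) (@adjD C d d) (_ : 0 ^t* = 0)).
      by apply: eq_bigr => j _; rewrite adjZ trC adjM trmxCK mulmxA.
    by rewrite linear0 map_mx0.
  by rewrite exchange_big.
pose c := \sum_i b i *m (b i) ^t*.
have Bc : B c.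
  apply: (big_ind B) => // [x y|i _]; first exact: commutantD.
  by apply: commutantM => //; exact: BT.
(* If [v *m c = 0], the squared norms of the [v *m b i] add up to zero; since the identity is a
   combination of the [b i], [v] is zero. *)
have cu : c \in unitmx.
  rewrite -row_free_unit -kermx_eq0; apply/rowV0P => v /sub_kermxP vc.
  have vb i : v *m b i = 0.
    have : \sum_i \tr ((v *m b i) ^t* ^t* *m (v *m b i) ^t*) = 0.
      transitivity (\tr (v *m c *m v ^t*)); last by rewrite vc mul0mx linear0.
      rewrite /c mulmx_sumr mulmx_suml linear_sum; apply: eq_bigr => k _.
      by rewrite trmxCK adjM !mulmxA.
    move=> /psumr_eq0P => /(_ (fun k _ => tr_adj_ge0 _)) /(_ i isT) /tr_adj_eq0.
    by move=> /(congr1 (fun x => x ^t*)); rewrite trmxCK linear0 map_mx0.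
  rewrite -[v]mulmx1 (gen _ (@commutant1 C d A)) mulmx_sumr big1 // => i _.
  by rewrite -scalemxAr vb scaler0.
have cC z : B z -> z *m c = c *m z.
  move=> Bz; apply/matrixP => i j.
  have qb : bilin (fun x y : M => (x *m y) i j).
    by split=> *; rewrite ?mulmxDl ?mulmxDr -?scalemxAl -?scalemxAr !mxE.
  have := C0 _ z qb Bz; rewrite /c mulmx_sumr mulmx_suml !summxE => e.
  transitivity (\sum_i0 (z *m b i0 *m (b i0) ^t*) i j).
    by apply: eq_bigr => k _; rewrite mulmxA.
  by rewrite e; apply: eq_bigr => k _; rewrite mulmxA.
have BV := commutantV Bc.
have vC z : B z -> z *m invmx c = invmx c *m z.
  move=> Bz; apply: (can_inj (mulKmx cu)); rewrite mulmxA -cC // mulmxK //.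
  by rewrite mulmxA mulmxV // mul1mx.
exists r, b, (fun i => (b i) ^t* *m invmx c); split=> //.
- by move=> i; apply: commutantM => //; exact: BT.
- move=> q qb.
  have q1 : bilin (fun x y => q x (y *m invmx c)).
    by split=> *; rewrite ?mulmxDl -?scalemxAl ?qb.1 ?qb.2.
  have q2 : bilin (fun x y => q (x *m invmx c) y).
    by split=> *; rewrite ?mulmxDl -?scalemxAl ?qb.1 ?qb.2.
  rewrite -(S0 _ q2); under [RHS]eq_bigr do rewrite vC //.
  by rewrite (C0 _ _ qb BV); apply: eq_bigr.
- move=> q z qb Bz.
  have q1 : bilin (fun x y => q x (y *m invmx c)).
    by split=> *; rewrite ?mulmxDl -?scalemxAl ?qb.1 ?qb.2.
  rewrite (C0 _ _ q1 Bz); apply: eq_bigr => i _.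
  by rewrite -!mulmxA vC.
by under eq_bigr do rewrite mulmxA; rewrite -mulmx_suml mulmxV.
Qed.

End Casimir.

(** * Forms evaluated on doubly stochastic Kraus families *)

Section DoublyStochastic.
Variables (C : numClosedFieldType) (d : nat).
Local Notation M := 'M[C]_d.

(** After the factorisation of [m], the two normalisations collapse the sum to [h 1 + g 1], that is
    [m 1 1], the value at the unitary 1. *)
Lemma bilin_unitary0_kraus (A : {pred M}) (AT : forall a, a \in A -> a ^t* \in A)
    (m : M -> M -> C) (I : finType) (V : I -> M) :
  bilin m ->
  (forall u, commutant A u -> u \is unitarymx -> m (u ^t*) u = 0) ->
  (forall i, commutant A (V i)) ->
  \sum_i (V i) ^t* *m V i = 1%:M -> \sum_i V i *m (V i) ^t* = 1%:M ->
  \sum_i m ((V i) ^t*) (V i) = 0.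
Proof.
move=> mb mU BV V1 V2.
have [r [e [f [Be Bf casS casC cas1]]]] := casimir AT.
have rel h := selfadj_rel mb mU (h := h).
have m2 h : selfadj (commutant A) h -> m h h = m (h *m h) 1%:M by case/rel.
have m3 h : selfadj (commutant A) h -> m (h *m h) h = m (h *m h *m h) 1%:M.
  by case/rel.
have [h [g [hl gl E]]] := bilin_factor (@commutantD C d A) (@commutantZ C d A)
  (@commutantM C d A) (@commutant1 C d A) (commutantT AT) mb m2 m3
  Be Bf casS casC cas1.
have lin_sum (q : M -> C) (ql : forall a x y, q (a *: x + y) = a * q x + q y)
    (F : I -> M) : \sum_i q (F i) = q (\sum_i F i).
  have q0 : q 0 = 0.
    by apply: (addIr (q 0)); rewrite add0r -[X in X + _]mul1r -ql scale1r addr0.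
  apply/esym; apply: (big_morph q) => [x y|//].
  by rewrite -[x]scale1r ql mul1r scale1r.
transitivity (\sum_i (h ((V i) ^t* *m V i) + g (V i *m (V i) ^t*))).
  by apply: eq_bigr => i _; apply: E => //; exact: commutantT.
rewrite big_split /= !lin_sum // V1 V2.
have B1 := @commutant1 C d A.
have := E _ _ B1 B1; rewrite mulmx1 => <-.
have := mU _ B1; rewrite adj1; apply.
by apply/unitarymxP; rewrite adj1 mulmx1.
Qed.

(** [psdmx] speaks only of the quadratic form; this recovers the hermitian symmetry that
    diagonalizing the Choi matrix requires, by polarizing with the phases 1 and ['i]. *)
Lemma form_hermitian n (T : 'M[C]_n) :
  (forall v : 'cV_n, ((v ^t* *m T *m v) 0 0)^* = (v ^t* *m T *m v) 0 0) ->
  T ^t* = T.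
Proof.
move=> real; pose D := T ^t* - T.
have q0 (v : 'cV_n) : (v ^t* *m D *m v) 0 0 = 0.
  rewrite mulmxBr mulmxBl mxE [X in _ + X]mxE -real -[(_ *m _) 0 0]trace_mx11.
  by rewrite tr_conj !adjM trmxCK mulmxA trace_mx11 subrr.
suff D0 : D = 0 by apply/eqP; rewrite -subr_eq0 -/D D0.
clearbody D; have dl (i j : 'I_n) :
    (delta_mx i 0 : 'cV[C]_n) ^t* *m D *m delta_mx j 0 = (D i j)%:M.
  rewrite trmx_delta map_delta_mx -rowE -colE.
  by apply/matrixP => a b; rewrite !ord1 !mxE.
have diag i : D i i = 0 by have := q0 (delta_mx i 0); rewrite dl !mxE.
have pol (a : C) i j : a * D i j + a^* * D j i = 0.
  have := q0 (delta_mx i 0 + a *: delta_mx j 0).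
  rewrite adjD adjZ !mulmxDl !mulmxDr -!scalemxAl -!scalemxAr !dl !mxE !diag.
  by rewrite !mulr0 !mulr1n !addr0 add0r.
apply/matrixP => i j; rewrite mxE.
have e1 := pol 1 i j; have e2 := pol 'i i j.
move: e1 e2; rewrite conjC1 !mul1r conjCi mulNr -mulrBr => e1 /eqP.
rewrite mulf_eq0 (negPf (neq0Ci _)) subr_eq0 => /eqP e2.
by move/eqP: e1; rewrite -e2 -mulr2n mulrn_eq0 => /eqP.
Qed.

End DoublyStochastic.

(** * Kraus decompositions *)

Section Channels.
Variable R : realType.
Local Notation C := (R[i]).
Variable d : nat.
Local Notation M := 'M[C]_d.

(** Choi's argument: [T] is the image under the amplification of the rank one matrix of the
    unnormalised maximally entangled vector [w], hence positive. *)
Lemma kraus (Phi : M -> M) : Defs.linearP Phi -> completely_positive Phi ->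
  exists n (V : 'I_n -> M), forall X, Phi X = \sum_s Ad (V s) X.
Proof.
move=> PL CP; pose n := (\sum_(i < d) d)%N.
pose T : 'M[C]_n := \mxblock_(i < d, j < d) Phi (delta_mx i j).
have Tpsd : psdmx T.
  pose w : 'cV[C]_n := \mxcol_(i < d) (delta_mx i 0 : 'cV[C]_d).
  have wt : w ^t* = \mxrow_(i < d) (delta_mx 0 i : 'rV[C]_d).
    rewrite tr_mxcol; apply/matrixP => i j; rewrite !mxE.
    by rewrite conjC_nat andbC.
  have <- : ampl Phi (w *m w ^t*) = T.
    rewrite /ampl wt mul_mxcol_mxrow; apply/eq_mxblockP => i j.
    by rewrite mxblockK mul_delta_mx.
  apply: CP => v; rewrite mulmxA -mulmxA -trace_mx11.
  have -> : v ^t* *m w = (w ^t* *m v) ^t* by rewrite adjM trmxCK.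
  exact: tr_adj_ge0.
have Th : T ^t* = T.
  apply: form_hermitian => v.
  by rewrite conj_Creal // ger0_real.
pose P := spectralmx T; pose l := spectral_diag T.
have Pu : P \is unitarymx by exact: spectral_unitarymx.
have PPt : P *m P ^t* = 1%:M by exact/unitarymxP.
have TE : T = P ^t* *m diag_mx l *m P.
  rewrite -(invmx_unitary Pu); apply: orthomx_spectralP.
  by apply/normalmxP; rewrite Th.
have l0 s : 0 <= l 0 s.
  have := Tpsd ((row s P) ^t*); rewrite trmxCK TE.
  rewrite rowE !mulmxA -[_ *m P *m P ^t*]mulmxA PPt mulmx1 adjM.
  rewrite !mulmxA -[_ *m P *m P ^t*]mulmxA PPt mulmx1 trmx_delta map_delta_mx.
  by rewrite -rowE -colE !mxE eqxx.
pose Q (i : 'I_d) : 'M[C]_(n, d) := submxrow (q_ := fun=> d) P i.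
have PhiE i j : Phi (delta_mx i j) = (Q i) ^t* *m diag_mx l *m Q j.
  have PE : P = \mxrow_(i < d) Q i by rewrite submxrowK.
  have PtE : P ^t* = \mxcol_(i < d) (Q i) ^t*.
    by rewrite {1}PE tr_mxrow; apply/matrixP => a b; rewrite !mxE.
  have := TE; rewrite PtE PE mxcol_mul mul_mxcol_mxrow => /mxblockP /(_ i j).
  by rewrite !mxblockK.
(* Row [s] of [P], a conjugated eigenvector of [T], cut into [d] blocks that become the rows of
   [V s]. *)
pose V s : M := \matrix_(i, b) (sqrtC (l 0 s) * Q i s b).
exists n, V => X.
have PhiS : {morph Phi : x y / x + y} by move=> x y; rewrite -[x]scale1r PL !scale1r.
have Phi0 : Phi 0 = 0 by apply: (addIr (Phi 0)); rewrite -PhiS !add0r.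
have PhiZ a x : Phi (a *: x) = a *: Phi x.
  by rewrite -[a *: x]addr0 PL Phi0 addr0.
rewrite [in LHS](matrix_sum_delta X) (big_morph Phi PhiS Phi0).
have -> : \sum_s Ad (V s) X = \sum_s \sum_i \sum_j X i j *: Ad (V s) (delta_mx i j).
  apply: eq_bigr => s _; rewrite /Ad {1}(matrix_sum_delta X).
  rewrite mulmx_sumr mulmx_suml; apply: eq_bigr => i _.
  rewrite mulmx_sumr mulmx_suml; apply: eq_bigr => j _.
  by rewrite -scalemxAr -scalemxAl.
rewrite [RHS]exchange_big; apply: eq_bigr => i _.
rewrite (big_morph Phi PhiS Phi0) [RHS]exchange_big; apply: eq_bigr => j _.
rewrite PhiZ -scaler_sumr; congr (_ *: _).
rewrite PhiE; apply/matrixP => a b; rewrite mul_mx_diag summxE !mxE.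
apply: eq_bigr => s _; rewrite /Ad -(mul_delta_mx (0 : 'I_1)) !mulmxA.
rewrite -colE -mulmxA -rowE [RHS]mxE big_ord1 !mxE rmorphM /=.
rewrite [(sqrtC _)^*]conj_Creal ?ger0_real ?sqrtC_ge0 //.
by rewrite mulrACA -expr2 sqrtCK [_ * l 0 s]mulrC mulrA.
Qed.

(** Multiplicative domain argument: for [X] in [A] the squared norms of the commutators of [X] with
    the Kraus operators sum to the trace of an expression in [Phi] at [X^* X], [X^*], [X] and 1, all
    fixed, and it cancels. *)
Lemma fixing_channel_kraus (A : {pred M}) (Phi : M -> M) :
  unital_Cstar_subalg A -> fixing_channels A Phi ->
  exists n (V : 'I_n -> M),
    [/\ forall s, commutant A (V s), \sum_s (V s) ^t* *m V s = 1%:M,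
        \sum_s V s *m (V s) ^t* = 1%:M & forall X, Phi X = \sum_s Ad (V s) X].
Proof.
move=> [A1 AD AZ AM AT] [[PL CP P1 Ptr] fixA].
have [n [V PV]] := kraus PL CP; exists n, V.
have V1 : \sum_s (V s) ^t* *m V s = 1%:M.
  by rewrite -P1 PV; apply: eq_bigr => s _; rewrite /Ad mulmx1.
split=> //.
- move=> s X XA; apply/esym/eqP; rewrite -subr_eq0; apply/eqP.
  have : \sum_s \tr ((X *m V s - V s *m X) ^t* *m (X *m V s - V s *m X)) = 0.
    rewrite -linear_sum /=.
    rewrite (_ : \sum_s _ = Phi (X ^t* *m X) - Phi (X ^t*) *m X
        - X ^t* *m Phi X + X ^t* *m Phi 1%:M *m X).
      rewrite !fixA ?P1 ?AM ?AT // mulmx1.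
      by rewrite subrr sub0r addNr linear0.
    rewrite !PV mulmx_suml !mulmx_sumr mulmx_suml -!sumrB -big_split /=.
    by apply: eq_bigr => k _; rewrite /Ad mulmx1 commutator_square.
  move=> /psumr_eq0P => /(_ (fun k _ => tr_adj_ge0 _)) /(_ s isT).
  exact: tr_adj_eq0.
(* Trace preservation, tested on the adjoint of the defect [D] itself, says that [D] has zero
   norm. *)
apply/eqP; rewrite -subr_eq0; apply/eqP; set D := _ - _.
apply: tr_adj_eq0; rewrite {2}/D mulmxBr mulmx1 linearB /= -[X in _ - X]Ptr.
rewrite PV mulmx_sumr ![\tr (\sum_s _)]linear_sum -sumrB big1 // => s _ /=.
by rewrite /Ad [X in _ - X]mxtrace_mulC !mulmxA mxtrace_mulC !mulmxA subrr.
Qed.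

End Channels.

(** * The span of unitary conjugations *)

Section LinearMaps.
Variables (C : numClosedFieldType) (d : nat).
Local Notation M := 'M[C]_d.

Lemma lin_mxE (f : M -> M) k l i j :
  lin_mx f (mxvec_index k l) (mxvec_index i j) = f (delta_mx k l) i j.
Proof. by rewrite /lin_mx mxE /= vec_mx_delta mxvecE. Qed.

(** [lin_mx] accepts any function and reads only its values on matrix units. *)
Lemma lin_mxP (f g : M -> M) :
  (forall k l, f (delta_mx k l) = g (delta_mx k l)) -> lin_mx f = lin_mx g.
Proof.
move=> e; apply/matrixP => p q; case/mxvec_indexP: p => k l.
by case/mxvec_indexP: q => i j; rewrite !lin_mxE e.
Qed.

Lemma lin_mx_lincomb (I : Type) (s : seq I) (c : I -> C) (f : I -> M -> M) :
  lin_mx (fun X => \sum_(i <- s) c i *: f i X) =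
  \sum_(i <- s) c i *: lin_mx (f i).
Proof.
apply/matrixP => p q; case/mxvec_indexP: p => k l.
case/mxvec_indexP: q => i j; rewrite lin_mxE !summxE.
by apply: eq_bigr => t _; rewrite !mxE /= vec_mx_delta mxvecE.
Qed.

Lemma lin_mxD a (f g : M -> M) :
  lin_mx (fun X => a *: f X + g X) = a *: lin_mx f + lin_mx g.
Proof.
apply/matrixP => p q; case/mxvec_indexP: p => k l.
by case/mxvec_indexP: q => i j; rewrite !mxE /= vec_mx_delta !mxvecE !mxE.
Qed.

Definition is_lin (f : M -> M) : Prop :=
  forall (a : C) X Y, f (a *: X + Y) = a *: f X + f Y.

Section IsLin.
Variable f : M -> M.
Hypothesis fl : is_lin f.
Lemma is_linD X Y : f (X + Y) = f X + f Y.
Proof. by rewrite -[X]scale1r fl !scale1r. Qed.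
Lemma is_lin0 : f 0 = 0.
Proof. by apply: (addIr (f 0)); rewrite -is_linD !add0r. Qed.
Lemma is_linZ a X : f (a *: X) = a *: f X.
Proof. by rewrite -[a *: X]addr0 fl is_lin0 addr0. Qed.
Lemma is_lin_sum (I : Type) (s : seq I) F :
  f (\sum_(i <- s) F i) = \sum_(i <- s) f (F i).
Proof. by apply: (big_morph f is_linD is_lin0). Qed.

Lemma is_lin_delta X : f X = \sum_k \sum_l X k l *: f (delta_mx k l).
Proof.
rewrite {1}(matrix_sum_delta X) is_lin_sum; apply: eq_bigr => k _.
by rewrite is_lin_sum; apply: eq_bigr => l _; rewrite is_linZ.
Qed.

Lemma mul_mxvec_lin_mx X : mxvec X *m lin_mx f = mxvec (f X).
Proof.
apply/rowP => q; case/mxvec_indexP: q => i j.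
rewrite mxvecE is_lin_delta mxE sum_mxvec summxE; apply: eq_bigr => k _.
by rewrite summxE; apply: eq_bigr => l _; rewrite mxvecE lin_mxE mxE.
Qed.
End IsLin.

Lemma lin_mx_eq (f g : M -> M) : is_lin f -> is_lin g ->
  lin_mx f = lin_mx g -> forall X, f X = g X.
Proof.
move=> fl gl e X; apply: (can_inj mxvecK).
by rewrite -!mul_mxvec_lin_mx // e.
Qed.

Lemma lin_mx_comp (f g : M -> M) : is_lin g ->
  lin_mx (fun X => g (f X)) = lin_mx f *m lin_mx g.
Proof.
move=> gl; apply/row_matrixP => p; case/mxvec_indexP: p => k l.
rewrite row_mul.
have r (h : M -> M) : row (mxvec_index k l) (lin_mx h) = mxvec (h (delta_mx k l)).
  by apply/rowP => q; case/mxvec_indexP: q => i j; rewrite mxE lin_mxE mxvecE.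
by rewrite !r mul_mxvec_lin_mx.
Qed.

Lemma two_sided_lin (a b : M) : is_lin (fun X => a *m X *m b).
Proof. by move=> t X Y; rewrite mulmxDr mulmxDl -scalemxAr -scalemxAl. Qed.

Lemma lincomb_lin (I : Type) (s : seq I) (c : I -> C) (f : I -> M -> M) :
  (forall i, is_lin (f i)) -> is_lin (fun X => \sum_(i <- s) c i *: f i X).
Proof.
move=> fl a X Y; rewrite scaler_sumr -big_split; apply: eq_bigr => i _ /=.
by rewrite fl scalerDr !scalerA mulrC.
Qed.

End LinearMaps.

Section UnitarySpan.
Variable R : realType.
Local Notation C := (R[i]).
Variable d : nat.
Local Notation M := 'M[C]_d.
Variable A : {pred M}.

Lemma Ad_lin (u : M) : is_lin (Ad u).
Proof. exact: two_sided_lin. Qed.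

(** A list whose span has maximal dimension: adjoining another unitary cannot enlarge it. *)
Lemma spanning_unitaries : exists s : seq M,
  (forall u, u \in s -> unitary_in A u) /\
  forall u, unitary_in A u ->
    lin_mx (Ad u) \in <<[seq lin_mx (Ad v) | v <- s]>>%VS.
Proof.
pose sp (s : seq M) := <<[seq lin_mx (Ad v) | v <- s]>>%VS.
pose P n := `[< exists s : seq M, (forall u, u \in s -> unitary_in A u) /\
   \dim (sp s) = n >].
have exP : exists n, P n by exists (\dim (sp [::])); apply/asboolP; exists [::].
have bd n : P n -> (n <= \dim {:'M[C]_(d * d, d * d)})%N.
  by move=> /asboolP [s [_ <-]]; apply/dimvS/subvf.
case: (ex_maxnP exP bd) => n /asboolP [s [su ds]] nmax.
exists s; split=> // u uu; have sub : (sp s <= sp (u :: s))%VS.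
  by rewrite /sp /= span_cons addvSr.
have : P (\dim (sp (u :: s))).
  apply/asboolP; exists (u :: s); split; last by []; move=> v.
  by rewrite inE => /orP[/eqP ->|/su].
move=> /nmax; rewrite -ds => le.
rewrite -/(sp s); have /eqP -> : sp s == sp (u :: s) by rewrite eqEdim sub le.
by rewrite /sp /= span_cons; apply: (subvP (addvSl _ _)); exact: memv_line.
Qed.

Hypothesis AT : forall a, a \in A -> a ^t* \in A.

(** The component [f] off [W] detects membership; each of its entries, evaluated at the map sending
    [X] to [a *m X *m b], is a bilinear form in [a] and [b] that vanishes on unitaries. *)
Lemma kraus_in_span (W : {vspace 'M[C]_(d * d, d * d)}) n (V : 'I_n -> M) :
  (forall u, unitary_in A u -> lin_mx (Ad u) \in W) ->
  (forall s, commutant A (V s)) -> \sum_s (V s) ^t* *m V s = 1%:M ->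
  \sum_s V s *m (V s) ^t* = 1%:M ->
  \sum_s lin_mx (Ad (V s)) \in W.
Proof.
move=> WU BV V1 V2; pose f (w : 'M[C]_(d * d, d * d)) := w - projv W w.
have fl a x y : f (a *: x + y) = a *: f x + f y.
  by rewrite /f linearP opprD addrACA scalerBr.
have fW w : w \in W -> f w = 0 by move=> ww; rewrite /f projv_id ?subrr.
pose m p q (a b : M) := f (lin_mx (fun X => a *m X *m b)) p q.
have mb p q : bilin (m p q).
  have fpq a (g h : M -> M) : f (lin_mx (fun X => a *: g X + h X)) p q =
      a * f (lin_mx g) p q + f (lin_mx h) p q.
    by rewrite lin_mxD fl mxE [X in X + _]mxE.
  split=> a x x' y; rewrite /m -fpq; congr (f _ p q); apply: lin_mxP => k l.
    by rewrite !mulmxDl -!scalemxAl.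
  by rewrite mulmxDr -scalemxAr.
set w := \sum_s _; suff fw : f w = 0.
  have -> : w = projv W w by apply/eqP; rewrite -subr_eq0 -/(f w) fw.
  exact: memv_proj.
apply/matrixP => p q; rewrite [RHS]mxE.
rewrite -[RHS](bilin_unitary0_kraus AT (mb p q) _ BV V1 V2).
  rewrite /w /m -summxE; congr (fun_of_matrix _ p q).
  have f0 : f 0 = 0 by rewrite /f linear0 subr0.
  by apply: (big_morph f) => // x y; rewrite -[x]scale1r fl !scale1r.
by move=> u Bu uu; rewrite /m fW ?mxE //; apply: WU.
Qed.

End UnitarySpan.

(** * The conditional expectation as a limit of averages *)

Section Expectation.
Variable R : realType.
Local Notation C := (R[i]).
Variable d : nat.
Local Notation M := 'M[C]_d.
Variables (A : {pred M}) (E : M -> M).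
Hypothesis Asub : unital_Cstar_subalg A.
Hypothesis EA : HS_orth_proj A E.

Let A1 : 1%:M \in A. Proof. by case: Asub. Qed.
Let AD X Y : X \in A -> Y \in A -> X + Y \in A.
Proof. by case: Asub => _ + _ _ _; apply. Qed.
Let AZ a X : X \in A -> a *: X \in A.
Proof. by case: Asub => _ _ + _ _; apply. Qed.
Let AM X Y : X \in A -> Y \in A -> X *m Y \in A.
Proof. by case: Asub => _ _ _ + _; apply. Qed.
Let AT X : X \in A -> X ^t* \in A. Proof. by case: Asub => _ _ _ _; apply. Qed.
Let Ein X : E X \in A. Proof. by case: (EA X). Qed.
Let Eorth X Y : Y \in A -> \tr (Y ^t* *m (X - E X)) = 0.
Proof. by case: (EA X) => _; apply. Qed.

(** [E] is known only as an orthogonal projection; linearity, the module property and invariance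
    under [Ad u] are all drawn from this uniqueness. *)
Lemma expectation_unique X Z : Z \in A ->
  (forall Y, Y \in A -> \tr (Y ^t* *m (X - Z)) = 0) -> E X = Z.
Proof.
move=> ZA Zo; apply/eqP; rewrite -subr_eq0; apply/eqP; apply: tr_adj_eq0.
have DA : E X - Z \in A by rewrite -scaleN1r; apply: AD => //; apply: AZ.
rewrite -[X in _ *m X](_ : (X - Z) - (X - E X) = _).
  by rewrite mulmxBr linearB /= Zo // Eorth // subrr.
by rewrite opprB addrC addrA subrK.
Qed.

Lemma expectation_id X : X \in A -> E X = X.
Proof.
by move=> XA; apply: expectation_unique => // Y _; rewrite subrr mulmx0 linear0.
Qed.

Lemma expectation_lin : is_lin E.
Proof.
move=> a X Y; apply: expectation_unique; first by apply: AD => //; apply: AZ.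
move=> Z ZA; rewrite opprD addrACA -scalerBr mulmxDr -scalemxAr.
by rewrite linearD linearZ /= !Eorth // mulr0 addr0.
Qed.

Lemma expectation_mull a X : a \in A -> E (a *m X) = a *m E X.
Proof.
move=> aA; apply: expectation_unique; first exact: AM.
move=> Y YA; rewrite -mulmxBr mulmxA -[a]trmxCK -adjM.
by apply: Eorth; apply: AM => //; exact: AT.
Qed.

Lemma expectation_Ad u X : unitary_in A u -> E (Ad u X) = E X.
Proof.
move=> [Bu uu]; apply: expectation_unique => // Y YA.
have uut : u *m u ^t* = 1%:M by apply/unitarymxP.
have comm : Y ^t* *m u ^t* = u ^t* *m Y ^t* by rewrite -!adjM Bu.
rewrite mulmxBr linearB /= -[X in _ - X](_ : \tr (Y ^t* *m X) = _).
  rewrite /Ad !mulmxA comm mxtrace_mulC !mulmxA uut mul1mx subrr //.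
by apply/eqP; rewrite -subr_eq0 -linearB -mulmxBr /= Eorth.
Qed.

(* [E] is left [A]-linear, so its matrix coefficients [V j l], read as matrices,
   lie in the commutant of [A]; an [X] commuting with them satisfies
   [E X = X *m E 1 = X]. *)
Lemma bicommutant X : (forall V, commutant A V -> V *m X = X *m V) -> X \in A.
Proof.
move=> XB; pose V j l : M := \matrix_(i, k) E (delta_mx k j) i l.
have EV Y i l : E Y i l = \sum_j (V j l *m Y) i j.
  rewrite (is_lin_delta expectation_lin) summxE.
  under eq_bigr do rewrite summxE.
  rewrite exchange_big; apply: eq_bigr => j _; rewrite [RHS]mxE.
  by apply: eq_bigr => k _; rewrite !mxE mulrC.
have BV j l : commutant A (V j l).
  move=> a aA; apply/matrixP => i k.
  transitivity (E (a *m delta_mx k j) i l); last first.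
    by rewrite expectation_mull // !mxE; apply: eq_bigr => t _; rewrite !mxE.
  have dE (Z : M) j' : (Z *m delta_mx k j) i j' = Z i k * (j' == j)%:R.
    rewrite mxE (bigD1 k) //= mxE eqxx andTb big1 ?addr0 // => t /negPf ne.
    by rewrite mxE ne mulr0.
  rewrite EV (bigD1 j) //= big1 => [|j' /negPf ne].
    by rewrite addr0 mulmxA dE eqxx mulr1.
  by rewrite mulmxA dE ne mulr0.
suff <- : E X = X by [].
apply/matrixP => i l; rewrite EV; under eq_bigr do rewrite XB //.
transitivity ((X *m E 1%:M) i l); last by rewrite expectation_id // mulmx1.
rewrite mxE; under eq_bigr do rewrite mxE; rewrite exchange_big.
apply: eq_bigr => k _ /=; rewrite EV mulr_sumr; apply: eq_bigr => j _.
by rewrite mulmx1.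
Qed.

(** Spectral projections [p] are recovered from the reflections [1 - 2 p], so unitaries detect
    commutation with the whole commutant. *)
Lemma bicommutant_unitary X :
  (forall u, unitary_in A u -> u *m X = X *m u) -> X \in A.
Proof.
move=> XU; apply: bicommutant => V BV.
have [h1 [h2 [hh1 hh2 ->]]] := selfadj_decomp (@commutantD C d A)
  (@commutantZ C d A) (commutantT AT) BV.
suff XH h : selfadj (commutant A) h -> h *m X = X *m h.
  by rewrite mulmxDl mulmxDr -scalemxAl -scalemxAr !XH.
move=> [Bh hh].
have Xp t : let p := fcalc h (fun x => (x == t)%:R) in p *m X = X *m p.
  move=> p; have pp : p *m p = p.
    rewrite fcalcM; apply: eq_fcalc => j; rewrite -natrM mulnb andbb //.
  have pt : p ^t* = p.
    by rewrite fcalc_adj; apply: eq_fcalc => j; rewrite rmorph_nat.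
  have Bp : commutant A p by exact: fcalc_commutant.
  clearbody p; have : (1%:M - 2 *: p) *m X = X *m (1%:M - 2 *: p).
    apply: XU; split.
      rewrite -scaleNr; apply: commutantD; first exact: commutant1.
      exact: commutantZ.
    exact: reflection_unitary.
  rewrite mulmxBl mulmxBr mul1mx mulmx1 => /addrI /oppr_inj.
  rewrite -scalemxAl -scalemxAr => /(congr1 (fun Y => 2^-1 *: Y)).
  by rewrite !scalerA mulVf ?pnatr_eq0 // !scale1r.
rewrite -[h](fcalc_id hh) fcalc_decomp mulmx_suml mulmx_sumr.
by apply: eq_bigr => t _; rewrite -scalemxAl -scalemxAr Xp.
Qed.

End Expectation.

(** * Spectrum of the uniform average *)

Section Averaging.
Variable R : realType.
Local Notation C := (R[i]).
Variable d : nat.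
Local Notation M := 'M[C]_d.
Variables (A : {pred M}) (E : M -> M).
Hypothesis Asub : unital_Cstar_subalg A.
Hypothesis EA : HS_orth_proj A E.

Lemma span_coef n (s : n.-tuple M) (f : M -> M) : is_lin f ->
  lin_mx f \in <<[seq lin_mx (Ad v) | v <- s]>>%VS ->
  forall X, f X =
    \sum_(i < n) coord (map_tuple (fun v => lin_mx (Ad v)) s) i (lin_mx f)
      *: Ad (tnth s i) X.
Proof.
move=> fl fs; apply: lin_mx_eq => //.
  by apply: lincomb_lin => i; exact: Ad_lin.
rewrite lin_mx_lincomb [LHS](coord_span (X := map_tuple _ s) fs).
apply: eq_bigr => i _; congr (_ *: _).
by rewrite -tnth_nth tnth_map.
Qed.

Lemma fixed_in_subalg (s : seq M) X :
  (forall u, unitary_in A u ->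
    lin_mx (Ad u) \in <<[seq lin_mx (Ad v) | v <- s]>>%VS) ->
  (forall u, u \in s -> Ad u X = X) ->
  (forall u, u \in s -> unitary_in A u) -> X \in A.
Proof.
move=> span fix_s su; apply: (bicommutant_unitary Asub EA) => u uu.
have sc := span_coef (s := in_tuple s) (Ad_lin u) (span _ uu).
have Ad1 (v : M) : v \is unitarymx -> Ad v 1%:M = 1%:M.
  by move=> vu; rewrite /Ad mulmx1 unitary_adjM.
have uX : Ad u X = X.
  (* At the identity, the expansion of [Ad u] says that its coefficients sum to 1; multiplying by
     [X] compares it with the expansion at [X]. *)
  have := sc 1%:M; rewrite Ad1 ?uu.2 // => /(congr1 (mulmxr X)) /=.
  rewrite mul1mx mulmx_suml => e; rewrite sc [RHS]e; apply: eq_bigr => i _.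
  have si : tnth (in_tuple s) i \in s by exact: mem_tnth.
  by rewrite fix_s // Ad1 -?scalemxAl ?mul1mx //; case: (su _ si).
have uut : u *m u ^t* = 1%:M by apply/unitarymxP; exact: uu.2.
by rewrite -{1}uX /Ad !mulmxA uut mul1mx.
Qed.

Definition avg (t : seq M) (X : M) : M :=
  (size t)%:R^-1 *: \sum_(u <- t) Ad u X.

Lemma avgE t X : avg t X = \sum_(u <- t) (size t)%:R^-1 *: Ad u X.
Proof. by rewrite /avg scaler_sumr. Qed.

Lemma avg_lin t : is_lin (avg t).
Proof.
move=> a X Y; rewrite /avg scalerA mulrC -scalerA -scalerDr; congr (_ *: _).
rewrite scaler_sumr -big_split; apply: eq_bigr => u _ /=; exact: Ad_lin.
Qed.

Lemma Ad_delta (u : M) k l i j : Ad u (delta_mx k l) i j = (u k i)^* * u l j.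
Proof.
rewrite /Ad -(mul_delta_mx (0 : 'I_1)) !mulmxA -colE -mulmxA -rowE.
by rewrite mxE big_ord1 !mxE.
Qed.

Lemma lin_mx_Ad_adj (u : M) : (lin_mx (Ad u)) ^t* = lin_mx (Ad (u ^t*)).
Proof.
apply/matrixP => p q; case/mxvec_indexP: p => k l.
case/mxvec_indexP: q => i j; rewrite [LHS]mxE [X in X^*]mxE !lin_mxE !Ad_delta.
by rewrite rmorphM /= conjCK !mxE conjCK.
Qed.

Lemma tr_Ad (u : M) X : u \is unitarymx ->
  \tr ((Ad u X) ^t* *m Ad u X) = \tr (X ^t* *m X).
Proof.
move=> /unitarymxP uut; rewrite /Ad !adjM trmxCK !mulmxA.
rewrite -[_ *m u *m u ^t*]mulmxA uut mulmx1 mxtrace_mulC !mulmxA.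
by rewrite uut mul1mx.
Qed.

Variable t : seq M.
Hypothesis tU : forall u, u \in t -> unitary_in A u.
Hypothesis t1 : 1%:M \in t.
Hypothesis tspan : forall u, unitary_in A u ->
  lin_mx (Ad u) \in <<[seq lin_mx (Ad v) | v <- t]>>%VS.

Let K : C := (size t)%:R.
Let K0 : 0 < K. Proof. by rewrite ltr0n; case: t t1. Qed.

(** The squared distances from [Ad u X] to [l *: X] sum to [K * N * (1 - |l|^2)]. So [l] is in the
    unit disc, and modulus one forces [Ad u X = l *: X] for all [u] in [t]; the member [1%:M] then
    gives [l = 1]. Otherwise invariance of [E] yields [E X = l *: E X]. *)
Lemma avg_eigen X l : X != 0 -> avg t X = l *: X ->
  (l = 1 /\ X \in A) \/ (`|l| < 1 /\ E X = 0).
Proof.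
move=> X0 aX; pose N := \tr (X ^t* *m X).
have N0 : 0 < N.
  rewrite lt_def tr_adj_ge0 andbT; apply: contra X0 => /eqP e.
  by apply/eqP; exact: tr_adj_eq0.
have sX : \sum_(u <- t) Ad u X = (K * l) *: X.
  by rewrite -scalerA -aX /avg scalerA mulfV ?scale1r // gt_eqF.
pose D u := Ad u X - l *: X.
have sD : \sum_(u <- t) \tr ((D u) ^t* *m D u) = K * N * (1 - `|l| ^+ 2).
  transitivity (\sum_(u <- t) (N * (1 + l * l^*)
     - l * \tr ((Ad u X) ^t* *m X) - l^* * \tr (X ^t* *m Ad u X))).
    rewrite !big_seq; apply: eq_bigr => u ut; have [_ uu] := tU ut.
    by rewrite /D tr_adj_subZ tr_Ad // -/N; ring.
  have trS (F : M -> M) : \sum_(u <- t) \tr (F u) = \tr (\sum_(u <- t) F u).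
    by rewrite linear_sum.
  rewrite !sumrB -!mulr_sumr !trS -mulmx_sumr -mulmx_suml sX.
  have -> : \sum_(u <- t) (Ad u X) ^t* = ((K * l) *: X) ^t*.
    rewrite -sX (big_morph (fun x : M => x ^t*) (@adjD C d d) (_ : 0 ^t* = 0)) //.
    by rewrite linear0 map_mx0.
  rewrite adjZ -scalemxAl -scalemxAr !mxtraceZ -/N big_const_seq count_predT.
  rewrite iter_addr_0 -mulr_natl -/K rmorphM /= (conj_Creal (gtr0_real K0)).
  by rewrite normCK; ring.
have l1 : `|l| ^+ 2 <= 1.
  rewrite -subr_ge0 -(pmulr_rge0 _ (mulr_gt0 K0 N0)) -sD.
  by apply: sumr_ge0 => u _; exact: tr_adj_ge0.
have [l2|l2] := eqVneq (`|l| ^+ 2) 1; last first.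
  have ll : `|l| < 1.
    by rewrite -(ltr_pXn2r (_ : 0 < 2)%N) ?nnegrE ?expr1n // lt_def eq_sym l2.
  right; split=> //.
  have : E (avg t X) = E X.
    rewrite avgE (is_lin_sum (expectation_lin Asub EA)).
    rewrite big_seq (eq_bigr (fun=> K^-1 *: E X)); last first.
      move=> u ut; rewrite (is_linZ (expectation_lin Asub EA)).
      by rewrite (expectation_Ad Asub EA) //; exact: tU.
    rewrite -big_seq big_const_seq count_predT iter_addr_0 -scaler_nat scalerA.
    by rewrite mulfV ?scale1r // gt_eqF.
  rewrite aX (is_linZ (expectation_lin Asub EA)) => /eqP.
  rewrite -subr_eq0 -[X in _ - X]scale1r -scalerBl scaler_eq0 => /orP[|/eqP //].
  by rewrite subr_eq0 => /eqP l1'; move: ll; rewrite l1' normr1 ltxx.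
have D0 u : u \in t -> Ad u X = l *: X.
  move=> ut; apply/eqP; rewrite -subr_eq0; apply/eqP; apply: tr_adj_eq0.
  move: sD; rewrite l2 subrr mulr0 => /eqP; rewrite psumr_eq0; last first.
    by move=> v _; exact: tr_adj_ge0.
  by move=> /allP /(_ _ ut) /eqP.
have l1' : l = 1.
  have := D0 _ t1; rewrite /Ad adj1 mul1mx mulmx1 => /eqP.
  rewrite -subr_eq0 -{1}[X]scale1r -scalerBl scaler_eq0 (negPf X0) orbF.
  by rewrite subr_eq0 => /eqP.
left; split=> //; apply: (fixed_in_subalg tspan) => // u /D0 ->.
by rewrite l1' scale1r.
Qed.

End Averaging.

Section Geometric.
Variable R : realType.
Local Notation C := (R[i]).

Lemma geometric_small (x e : C) : `|x| < 1 -> 0 < e ->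
  exists n, forall m, (n <= m)%N -> `|x| ^+ m <= e.
Proof.
rewrite normc_def; set r := Num.sqrt _ => x1 e0.
have er : e = (complex.Re e)%:C%C.
  by case: e e0 => a b; rewrite ltcE /= => /andP[/eqP -> _].
have e0' : 0 < complex.Re e by move: e0; rewrite {1}er ltcR.
have r0 : 0 <= r by exact: sqrtr_ge0.
have r1 : r < 1 by move: x1; rewrite ltcR.
have [rz|rn0] := eqVneq r 0.
  exists 1%N => m m0; rewrite rz rmorph0 expr0n; case: m m0 => // m _ /=.
  exact: ltW.
have rp : 0 < r by rewrite lt_def rn0.
(* Bernoulli's inequality for [r^-1 = 1 + h] gives the decay. *)
pose h := r^-1 - 1.
have h0 : 0 < h by rewrite subr_gt0 invf_gt1.
have bern n : 1 + n%:R * h <= (1 + h) ^+ n.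
  elim: n => [|n IH]; first by rewrite mul0r addr0 expr0.
  rewrite exprS; apply: le_trans (_ : (1 + h) * (1 + n%:R * h) <= _); last first.
    by rewrite ler_wpM2l // addr_ge0 // ltW.
  rewrite -natr1 -subr_ge0.
  have -> : (1 + h) * (1 + n%:R * h) - (1 + (n%:R + 1) * h) = n%:R * h * h by ring.
  by rewrite !mulr_ge0 // ltW.
have [n nP] : exists n : nat, (complex.Re e)^-1 / h <= n%:R.
  exists (Num.bound ((complex.Re e)^-1 / h)); apply: ltW; apply: archi_boundP.
  by rewrite divr_ge0 // ?invr_ge0 ltW.
exists n => m nm; rewrite -rmorphXn /= er lecR.
have hr : 1 + h = r^-1 by rewrite /h addrC subrK.
have := bern m; rewrite hr exprVn => b.
rewrite -[X in _ <= X]invrK -[X in X <= _]invrK lef_pV2 ?posrE ?invr_gt0 ?exprn_gt0 //.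
apply: le_trans b; apply: le_trans (_ : n%:R * h <= _).
  by rewrite -ler_pdivrMr.
by apply: le_trans (_ : m%:R * h <= _); rewrite ?ler_pM2r ?ler_nat ?lerDr.
Qed.

End Geometric.

Section Convergence.
Variable R : realType.
Local Notation C := (R[i]).
Variable d : nat.
Local Notation M := 'M[C]_d.
Variables (A : {pred M}) (E : M -> M).
Hypothesis Asub : unital_Cstar_subalg A.
Hypothesis EA : HS_orth_proj A E.
Variable t : seq M.
Hypothesis tU : forall u, u \in t -> unitary_in A u.
Hypothesis t1 : 1%:M \in t.
Hypothesis tspan : forall u, unitary_in A u ->
  lin_mx (Ad u) \in <<[seq lin_mx (Ad v) | v <- t]>>%VS.
Hypothesis tT : \sum_(u <- t) lin_mx (Ad (u ^t*)) = \sum_(u <- t) lin_mx (Ad u).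

Lemma lin_mx_avg :
  lin_mx (avg t) = (size t)%:R^-1 *: \sum_(u <- t) lin_mx (Ad u).
Proof.
rewrite scaler_sumr -lin_mx_lincomb; apply: lin_mxP => k l.
by rewrite avgE.
Qed.

Lemma lin_mx_avg_adj : (lin_mx (avg t)) ^t* = lin_mx (avg t).
Proof.
rewrite lin_mx_avg adjZ conj_Creal ?realV ?realn //; congr (_ *: _).
rewrite (big_morph (fun x : 'M[C]_(d * d, d * d) => x ^t*)
  (@adjD C (d * d) (d * d)) (_ : 0 ^t* = 0)); last by rewrite linear0 map_mx0.
by rewrite -tT; apply: eq_bigr => u _; rewrite lin_mx_Ad_adj.
Qed.

Let P := spectralmx (lin_mx (avg t)).
Let l := spectral_diag (lin_mx (avg t)).

Let Pu : P \is unitarymx. Proof. exact: spectral_unitarymx. Qed.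
Let PPt : P *m P ^t* = 1%:M. Proof. exact/unitarymxP. Qed.
Let avgD : lin_mx (avg t) = P ^t* *m diag_mx l *m P.
Proof.
rewrite -(invmx_unitary Pu); apply: orthomx_spectralP.
by apply/normalmxP; rewrite lin_mx_avg_adj.
Qed.

Let iterD n : lin_mx (iter n (avg t)) =
  P ^t* *m diag_mx (map_mx (fun x => x ^+ n) l) *m P.
Proof.
elim: n => [|n IH].
  rewrite (_ : map_mx _ l = const_mx 1); last by apply/rowP => j; rewrite !mxE.
  rewrite diag_const_mx mulmx1 unitary_adjM //.
  apply/row_matrixP => p; rewrite row1; case/mxvec_indexP: p => k i.
  rewrite -mxvec_delta; apply/rowP => q; case/mxvec_indexP: q => j j'.
  by rewrite mxE lin_mxE mxvecE.
have avgl := avg_lin t.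
transitivity (lin_mx (fun X => avg t (iter n (avg t) X))); first by [].
rewrite (lin_mx_comp (iter n (avg t)) avgl) IH avgD !mulmxA.
rewrite -[_ *m P *m P ^t*]mulmxA PPt mulmx1 -[P ^t* *m _ *m _]mulmxA diag_mxM.
apply: (congr1 (fun v => P ^t* *m diag_mx v *m P)); apply/rowP => j.
by rewrite [LHS]mxE [X in X * _]mxE [RHS]mxE exprSr.

Qed.

Let eigP i : avg t (vec_mx (row i P)) = l 0 i *: vec_mx (row i P).
Proof.
apply: (can_inj mxvecK); rewrite -(mul_mxvec_lin_mx (avg_lin t)) vec_mxK avgD.
rewrite !mulmxA rowE -[_ *m P *m P ^t*]mulmxA PPt mulmx1 -rowE linearZ /= vec_mxK.
by rewrite row_diag_mx -scalemxAl -rowE.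
Qed.

Let row_neq0 i : vec_mx (row i P) != 0 :> M.
Proof.
apply/eqP => /(congr1 mxvec); rewrite vec_mxK linear0 => e.
have /matrixP/(_ i i) := PPt; rewrite !mxE eqxx big1 => [/eqP|j _].
  by rewrite eq_sym oner_eq0.
by have /rowP/(_ j) := e; rewrite !mxE => ->; rewrite mul0r.
Qed.

(** By the dichotomy [avg_eigen], the eigenbasis of the average also diagonalizes [E]. *)
Let ED : lin_mx E = P ^t* *m diag_mx (map_mx (fun x => (x == 1)%:R) l) *m P.
Proof.
rewrite -[LHS]mul1mx -(unitary_adjM Pu) -!mulmxA; congr (_ *m _).
apply/row_matrixP => i; rewrite !row_mul row_diag_mx -scalemxAl -rowE mxE.
rewrite -[row i P]vec_mxK (mul_mxvec_lin_mx (expectation_lin Asub EA)) -linearZ.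
congr mxvec.
have [[e XA]|[l1 EX]] := avg_eigen Asub EA tU t1 tspan (row_neq0 i) (eigP i).
  by rewrite (expectation_id Asub EA) // e eqxx scale1r.
rewrite EX; case: eqP l1 => [->|_ _]; first by rewrite normr1 ltxx.
by rewrite scale0r.
Qed.

Lemma unitary_entry n (U : 'M[C]_n) i j : U \is unitarymx -> `|U i j| <= 1.
Proof.
move=> /unitarymxP /matrixP /(_ i i); rewrite !mxE eqxx mulr1n => e.
rewrite -(ler_pXn2r (_ : 0 < 2)%N) ?nnegrE ?expr1n // -e (bigD1 j) //=.
rewrite !mxE -normCK lerDl; apply: sumr_ge0 => k _; rewrite !mxE.
exact: mul_conjC_ge0.
Qed.

Lemma avg_converges (e : C) : 0 < e ->
  exists n, forall p q, `|lin_mx (iter n.+1 (avg t)) p q - lin_mx E p q| <= e.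
Proof.
(* Each of the [d * d] eigenvectors may contribute [e']; the successor keeps the denominator
   nonzero. *)
move=> e0; pose e' := e / (d * d).+1%:R.
have e'0 : 0 < e' by rewrite divr_gt0 // ltr0n.
have ex i : exists n, forall m, (n <= m)%N -> l 0 i != 1 -> `|l 0 i| ^+ m <= e'.
  have [[e1 _]|[l1 _]] := avg_eigen Asub EA tU t1 tspan (row_neq0 i) (eigP i).
    by exists 0 => m _; rewrite e1 eqxx.
  by have [n nP] := geometric_small l1 e'0; exists n => m /nP.
have [f fP] := fin_all_exists ex.
exists (\max_i f i) => p q; rewrite iterD ED !mxE -sumrB.
apply: le_trans (ler_norm_sum _ _ _) _.
apply: le_trans (_ : \sum_(i < d * d) e' <= _); last first.
  rewrite sumr_const card_ord /e' -[X in X <= _]mulr_natr mulrAC.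
  by rewrite ler_pdivrMr ?ltr0n // ler_pM2l // ler_nat.
apply: ler_sum => i _; rewrite !mul_mx_diag !mxE -mulrBl -mulrBr !normrM norm_conjC.
have w1 := unitary_entry i p Pu; have w2 := unitary_entry i q Pu.
apply: le_trans (_ : 1 * `|l 0 i ^+ (\max_i f i).+1 - (l 0 i == 1)%:R| * 1 <= _).
  by rewrite ler_pM ?mulr_ge0 ?normr_ge0 // ler_wpM2r ?normr_ge0.
rewrite mul1r mulr1; have [->|l1] := eqVneq (l 0 i) 1.
  by rewrite expr1n subrr normr0 ltW.
rewrite subr0 normrX; apply: fP => //; apply: leqW; exact: leq_bigmax.
Qed.

End Convergence.

(** * Mixtures of unitary conjugations *)

Section Mixtures.
Variable R : realType.
Local Notation C := (R[i]).
Variable d : nat.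
Local Notation M := 'M[C]_d.
Variable A : {pred M}.
Hypothesis AT : forall a, a \in A -> a ^t* \in A.

(** A free total weight [w] makes mixtures additive; unitaries of the commutant let a defect be
    pulled back without leaving the span of the [Ad u]. *)
Definition umix (w : C) (f : M -> M) : Prop := exists s : seq (C * M),
  [/\ forall q, q \in s -> 0 <= q.1 /\ unitary_in A q.2,
      \sum_(q <- s) q.1 = w & forall X, f X = \sum_(q <- s) q.1 *: Ad q.2 X].

Lemma umixD w w' f g : umix w f -> umix w' g ->
  umix (w + w') (fun X => f X + g X).
Proof.
move=> [s [s1 <- s3]] [s' [s1' <- s3']]; exists (s ++ s'); split=> [q||X].
- by rewrite mem_cat => /orP[/s1|/s1'].
- by rewrite big_cat.
by rewrite big_cat s3 s3'.
Qed.

Lemma umixZ a w f : 0 <= a -> umix w f -> umix (a * w) (fun X => a *: f X).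
Proof.
move=> a0 [s [s1 <- s3]]; exists [seq (a * q.1, q.2) | q <- s]; split=> [q||X].
- by move=> /mapP[q' /s1 [h1 h2] ->]; split; [exact: mulr_ge0 | exact: h2].
- by rewrite big_map mulr_sumr.
by rewrite big_map s3 scaler_sumr; apply: eq_bigr => q _; rewrite scalerA.
Qed.

Lemma umix_sum (I : eqType) (s : seq I) w (f : I -> M -> M) :
  (forall i, i \in s -> umix (w i) (f i)) ->
  umix (\sum_(i <- s) w i) (fun X => \sum_(i <- s) f i X).
Proof.
elim: s => [|i s IH] h.
  by exists [::]; split=> [//||X]; rewrite !big_nil.
have [|s' [s1 s2 s3]] := umixD (h i (mem_head _ _)) (IH _).
  by move=> j js; apply: h; rewrite inE js orbT.
exists s'; split=> // [|X]; first by rewrite s2 big_cons.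
by rewrite -s3 big_cons.
Qed.

Lemma umix_Ad_comp u w f : unitary_in A u -> umix w f ->
  umix w (fun X => Ad u (f X)).
Proof.
move=> uu [s [s1 s2 s3]]; exists [seq (q.1, q.2 *m u) | q <- s]; split=> [q||X].
- by move=> /mapP[q' /s1 [h1 h2] ->]; split; [|exact: (unitary_inM h2 uu)].
- by rewrite big_map.
rewrite big_map s3 (is_lin_sum (Ad_lin u)); apply: eq_bigr => q _ /=.
by rewrite (is_linZ (Ad_lin u)) /Ad adjM !mulmxA.
Qed.

Lemma umix_id : umix 1 id.
Proof.
exists [:: (1, 1%:M)]; split=> [q||X]; rewrite ?big_seq1 //.
- by rewrite inE => /eqP -> /=; split=> //; exact: unitary_in1.
by rewrite scale1r /Ad adj1 mul1mx mulmx1.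
Qed.

Lemma umix_mixed_unitary f : umix 1 f -> mixed_unitary f.
Proof.
move=> [s [s1 s2 s3]]; pose T := in_tuple s.
exists (size s), (fun j => (tnth T j).1), (fun j => (tnth T j).2).
have sT j : tnth T j \in s by exact: mem_tnth.
split=> [j|j||X].
- by have [_ []] := s1 _ (sT j).
- by have [] := s1 _ (sT j).
- by rewrite -[RHS]s2 [RHS](big_tnth _ _ s).
by rewrite s3 (big_tnth _ _ s).
Qed.

(** Shared by the given channel and by the mixtures, stable under composition with [Ad u], and
    enough to lie in the span. *)
Definition ds_kraus (f : M -> M) : Prop := exists n (V : 'I_n -> M),
  [/\ forall s, commutant A (V s), \sum_s (V s) ^t* *m V s = 1%:M,
      \sum_s V s *m (V s) ^t* = 1%:M & forall X, f X = \sum_s Ad (V s) X].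

Lemma umix_ds_kraus f : umix 1 f -> ds_kraus f.
Proof.
move=> [s [s1 s2 s3]]; pose T := in_tuple s.
have sT j : tnth T j \in s by exact: mem_tnth.
pose c j := sqrtC (tnth T j).1.
have cc j : c j * (c j)^* = (tnth T j).1.
  have [q0 _] := s1 _ (sT j).
  by rewrite conj_Creal ?ger0_real ?sqrtC_ge0 // -expr2 sqrtCK.
have sum1 : \sum_j (tnth T j).1 = 1 by rewrite -[RHS]s2 [RHS](big_tnth _ _ s).
exists (size s), (fun j => c j *: (tnth T j).2); split=> [j|||X].
- by have [_ [+ _]] := s1 _ (sT j); exact: commutantZ.
- rewrite -[RHS]scale1r -[X in _ = X *: _]sum1 scaler_suml; apply: eq_bigr => j _.
  have [_ [_ uu]] := s1 _ (sT j).
  by rewrite adjZ -scalemxAl -scalemxAr scalerA mulrC cc unitary_adjM.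
- rewrite -[RHS]scale1r -[X in _ = X *: _]sum1 scaler_suml; apply: eq_bigr => j _.
  have [_ [_ /unitarymxP uu]] := s1 _ (sT j).
  by rewrite adjZ -scalemxAl -scalemxAr scalerA cc uu.
rewrite s3 (big_tnth _ _ s); apply: eq_bigr => j _.
by rewrite /Ad adjZ -!scalemxAl -scalemxAr scalerA mulrC cc.
Qed.

Section DsKraus.
Variable f : M -> M.
Hypothesis fk : ds_kraus f.

Lemma ds_kraus_lin : is_lin f.
Proof.
have [n [V [_ _ _ fE]]] := fk; move=> a X Y.
rewrite !fE scaler_sumr -big_split; apply: eq_bigr => s _; exact: Ad_lin.
Qed.

Lemma ds_kraus1 : f 1%:M = 1%:M.
Proof.
have [n [V [_ V1 _ fE]]] := fk.
by rewrite fE -[RHS]V1; apply: eq_bigr => s _; rewrite /Ad mulmx1.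
Qed.

Lemma adj_sum (I : Type) (s : seq I) (F : I -> M) :
  (\sum_(i <- s) F i) ^t* = \sum_(i <- s) (F i) ^t*.
Proof.
apply: (big_morph (fun x : M => x ^t*) (@adjD C d d)).
by rewrite linear0 map_mx0.
Qed.

Lemma Ad_adj (u X : M) : Ad u (X ^t*) = (Ad u X) ^t*.
Proof. by rewrite /Ad !adjM trmxCK mulmxA. Qed.

Lemma ds_kraus_adj X : f (X ^t*) = (f X) ^t*.
Proof.
have [n [V [_ _ _ fE]]] := fk.
by rewrite !fE adj_sum; apply: eq_bigr => s _; rewrite Ad_adj.
Qed.

Lemma ds_kraus_Ad_comp u : unitary_in A u -> ds_kraus (fun X => Ad u (f X)).
Proof.
have [n [V [BV V1 V2 fE]]] := fk; move=> [Bu uu]; exists n, (fun s => V s *m u).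
split=> [s|||X]; first exact: commutantM.
- transitivity (u ^t* *m (\sum_s (V s) ^t* *m V s) *m u).
    rewrite mulmx_sumr mulmx_suml; apply: eq_bigr => s _.
    by rewrite adjM !mulmxA.
  by rewrite V1 mulmx1 unitary_adjM.
- rewrite -V2; apply: eq_bigr => s _.
  by rewrite adjM mulmxA mulmxtVK // -trmxC_unitary.
rewrite fE (is_lin_sum (Ad_lin u)); apply: eq_bigr => s _.
by rewrite /Ad adjM !mulmxA.
Qed.

Lemma ds_kraus_span (W : {vspace 'M[C]_(d * d, d * d)}) :
  (forall u, unitary_in A u -> lin_mx (Ad u) \in W) -> lin_mx f \in W.
Proof.
move=> WU; have [n [V [BV V1 V2 fE]]] := fk.
have -> : lin_mx f = \sum_s lin_mx (Ad (V s)).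
  transitivity (\sum_s 1 *: lin_mx (Ad (V s))).
    rewrite -lin_mx_lincomb; apply: lin_mxP => k l; rewrite fE.
    by apply: eq_bigr => s _; rewrite scale1r.
  by apply: eq_bigr => s _; rewrite scale1r.
exact: (kraus_in_span AT WU BV V1 V2).
Qed.

End DsKraus.
End Mixtures.

(** * Absorbing a small perturbation into the uniform weights *)

Section Perturbation.
Variable R : realType.
Local Notation C := (R[i]).
Variable d : nat.
Local Notation M := 'M[C]_d.
Variable A : {pred M}.
Variable t : seq M.
Hypothesis tU : forall u, u \in t -> unitary_in A u.
Hypothesis t1 : 1%:M \in t.
Hypothesis d0 : (0 < d)%N.

Let K : C := (size t)%:R.
Let K0 : 0 < K. Proof. by rewrite ltr0n; case: t t1. Qed.
Let T := in_tuple t.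
Let cf i := coord (map_tuple (fun v => lin_mx (Ad v)) T) i.

(** [coord] is linear in [w] even for a dependent list, so its values on matrix units bound it. The
    added 1 keeps [L] positive. *)
Lemma coef_bound : exists L : C, 0 < L /\
  forall (w : 'M[C]_(d * d, d * d)) (b : C), (forall p q, `|w p q| <= b) ->
  forall i, `|cf i w| <= L * b.
Proof.
exists (1 + \sum_i \sum_p \sum_q `|cf i (delta_mx p q)|).
have S0 i : 0 <= \sum_p \sum_q `|cf i (delta_mx p q)|.
  by apply: sumr_ge0 => p _; apply: sumr_ge0.
split; first by rewrite ltr_pwDl // sumr_ge0.
move=> w b wb i.
have b0 : 0 <= b.
  have dd : (0 < d * d)%N by rewrite muln_gt0 d0.
  exact: le_trans (wb (Ordinal dd) (Ordinal dd)).
apply: le_trans (_ : (\sum_p \sum_q `|cf i (delta_mx p q)|) * b <= _); last first.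
  rewrite ler_wpM2r // (bigD1 i) //= addrCA lerDl.
  by rewrite addr_ge0 // sumr_ge0.
rewrite {1}(matrix_sum_delta w) /cf linear_sum mulr_suml.
apply: le_trans (ler_norm_sum _ _ _) _; apply: ler_sum => p _.
rewrite linear_sum mulr_suml.
apply: le_trans (ler_norm_sum _ _ _) _; apply: ler_sum => q _.
by rewrite linearZ normrM mulrC ler_wpM2l.
Qed.

(* A hermitian-preserving map annihilating the identity is a real combination of
   the [Ad u], [u] in [t], with zero total weight, so it can be absorbed in the
   uniform weights of [avg t]. *)
Lemma umix_avg_add (f : M -> M) : is_lin f ->
  lin_mx f \in <<[seq lin_mx (Ad v) | v <- t]>>%VS ->
  (forall X, f (X ^t*) = (f X) ^t*) -> f 1%:M = 0 ->
  (forall i, `|cf i (lin_mx f)| <= K^-1) ->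
  umix A 1 (fun X => avg t X + f X).
Proof.
move=> fl fs fT f1 cb; pose c i := cf i (lin_mx f).
have fE X : f X = \sum_i c i *: Ad (tnth T i) X by exact: span_coef.
(* The coefficients of [f] need not be unique or real; the conjugate ones also represent [f], which
   commutes with the adjoint, and hence so do the real parts. *)
pose e i := 2^-1 * (c i + (c i)^*).
have fE' X : f X = \sum_i e i *: Ad (tnth T i) X.
  have fEc : f X = \sum_i (c i)^* *: Ad (tnth T i) X.
    rewrite -[f X]trmxCK -fT fE adj_sum; apply: eq_bigr => i _.
    by rewrite adjZ Ad_adj trmxCK.
  transitivity (2^-1 *: (f X + f X)).
    by rewrite -mulr2n -[f X *+ 2]scaler_nat scalerA mulVf ?scale1r ?pnatr_eq0.
  rewrite {1}fE fEc -big_split scaler_sumr; apply: eq_bigr => i _ /=.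
  by rewrite -scalerDl scalerA.
have tT i : tnth T i \in t by exact: mem_tnth.
have e_real i : e i \is Num.real.
  rewrite CrealE rmorphM rmorphD /= conjCK [(c i)^* + _]addrC.
  by rewrite [(2^-1)^*]conj_Creal // realV realn.
have e_bound i : 0 <= K^-1 + e i.
  have : `|e i| <= K^-1.
    rewrite normrM ger0_norm ?invr_ge0 ?ler0n // ler_pdivrMl ?ltr0n //.
    apply: le_trans (ler_normD _ _) _; rewrite norm_conjC -mulr2n mulr_natl.
    by rewrite lerMn2r cb orbT.
  by rewrite real_ler_norml // => /andP[h _]; rewrite addrC -lerBlDr sub0r.
have Ad1 i : Ad (tnth T i) 1%:M = 1%:M.
  by have [_ uu] := tU (tT i); rewrite /Ad mulmx1 unitary_adjM.
(* Every [Ad u] fixes the identity, so any diagonal entry of [f 1] is the total weight. *)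
have e_sum : \sum_i e i = 0.
  have := f1; rewrite fE' => /matrixP /(_ (Ordinal d0) (Ordinal d0)).
  rewrite summxE [in X in _ = X -> _]mxE => s0; rewrite -[RHS]s0; apply: eq_bigr => i _.
  by rewrite Ad1 !mxE eqxx mulr1.
have w1 : \sum_(i < size t) (K^-1 + e i) = 1.
  by rewrite big_split /= e_sum addr0 sumr_const card_ord -mulr_natl mulfV ?gt_eqF.
have := @umix_sum R d A _ (index_enum 'I_(size t)) (fun i => (K^-1 + e i) * 1)
  (fun i X => (K^-1 + e i) *: Ad (tnth T i) X).
case=> [i _|s [s1 s2 s3]].
  apply: umixZ => //; rewrite -[1]/(1 : C).
  have := umix_Ad_comp (tU (tT i)) (umix_id A).
  by [].
exists s; split=> // [|X].
  by rewrite s2 -[RHS]w1; apply: eq_bigr => i _; rewrite mulr1.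
rewrite -s3 avgE fE' (big_tnth _ _ t) -big_split; apply: eq_bigr => i _ /=.
by rewrite scalerDl.
Qed.

End Perturbation.

(** * Channels near a power of the average *)

Section Assembly.
Variable R : realType.
Local Notation C := (R[i]).
Variable d : nat.
Local Notation M := 'M[C]_d.

Lemma umix_iter_avg (A : {pred M}) (t : seq M) :
  (forall a, a \in A -> a ^t* \in A) -> (forall u, u \in t -> unitary_in A u) ->
  1%:M \in t -> forall n, umix A 1 (iter n (avg t)).
Proof.
move=> AT tU t1; elim=> [|n IH]; first exact: umix_id.
have K0 : (size t)%:R != 0 :> C by rewrite pnatr_eq0 -lt0n; case: (t) t1.
have [|s [s1 s2 s3]] := @umix_sum R d A _ t (fun=> (size t)%:R^-1 * 1)
    (fun u X => (size t)%:R^-1 *: Ad u (iter n (avg t) X)).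
  move=> u /tU uu; apply: umixZ; first by rewrite invr_ge0 ler0n.
  exact: umix_Ad_comp.
exists s; split=> // [|X]; last by rewrite -s3 /= avgE.
by rewrite s2 mulr1 big_const_seq count_predT iter_addr_0 -[_^-1 *+ _]mulr_natl mulfV.
Qed.

Lemma AdK (u X : M) : u \is unitarymx -> Ad u (Ad (u ^t*) X) = X.
Proof.
move=> uu; rewrite /Ad trmxCK !mulmxA unitary_adjM // mul1mx -mulmxA.
by rewrite unitary_adjM // mulmx1.
Qed.

Lemma normr_normc (z : C) : `|z| = (ComplexField.Normc.normc z)%:C%C.
Proof. by rewrite normc_def; case: z. Qed.

(* Write [E] approximately as the mixture [iter n (avg t)] of the [Ad q.2].
   The defect [D] of [Phi] is pulled back by each [q.2] and absorbed by one
   further factor [avg t]. *)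
Lemma umix_near_iter (A : {pred M}) (t : seq M) (Phi : M -> M) (L eps : C) n :
  (0 < d)%N -> (forall a, a \in A -> a ^t* \in A) ->
  (forall u, u \in t -> unitary_in A u) -> 1%:M \in t ->
  (forall u, unitary_in A u ->
    lin_mx (Ad u) \in <<[seq lin_mx (Ad v) | v <- t]>>%VS) ->
  (forall (w : 'M[C]_(d * d, d * d)) (b : C), (forall p q, `|w p q| <= b) ->
    forall i,
    `|coord (map_tuple (fun v => lin_mx (Ad v)) (in_tuple t)) i w| <= L * b) ->
  L * ((d * d)%:R * eps) <= (size t)%:R^-1 ->
  ds_kraus A Phi ->
  (forall p q, `|lin_mx Phi p q - lin_mx (iter n.+1 (avg t)) p q| <= eps) ->
  umix A 1 Phi.
Proof.
move=> d0 AT tU t1 tspan cL Leps Pk close.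
have gk := umix_ds_kraus (umix_iter_avg AT tU t1 n.+1).
have gE X : iter n.+1 (avg t) X = iter n (avg t) (avg t X) by rewrite iterSr.
set g := iter n.+1 (avg t) in close gk gE; clearbody g.
pose D X := Phi X - g X.
have DE u X : Ad u (D X) = Ad u (Phi X) - Ad u (g X).
  by rewrite /Ad /D mulmxBr mulmxBl.
have D_lin : is_lin D.
  move=> a X Y; rewrite /D (ds_kraus_lin Pk) (ds_kraus_lin gk).
  by rewrite opprD addrACA -scalerBr.
have [s [s1 s2 s3]] := umix_iter_avg AT tU t1 n.
(* Conjugating by [q.2] undoes the pull-back, so each term contributes [q.1 *: D X], and the weights
   sum to 1. *)
have [|s' [s1' s2' s3']] := @umix_sum R d A _ s (fun q => q.1 * 1)
    (fun q X => q.1 *: Ad q.2 (avg t X + Ad (q.2 ^t*) (D X))).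
  move=> q qs; have [q0 qU] := s1 _ qs; apply: umixZ => //.
  apply: umix_Ad_comp => //; pose u := q.2 ^t*; rewrite -/u.
  have uU : unitary_in A u.
    exact: (unitary_inT AT qU).
  have Pku := ds_kraus_Ad_comp Pk uU; have gku := ds_kraus_Ad_comp gk uU.
  have f_lin : is_lin (fun X => Ad u (D X)).
    by move=> a X Y; rewrite D_lin (Ad_lin u).
  apply: umix_avg_add => //.
  - have -> : lin_mx (fun X => Ad u (D X)) =
        (-1) *: lin_mx (fun X => Ad u (g X))
        + lin_mx (fun X => Ad u (Phi X)).
      rewrite -lin_mxD; apply: lin_mxP => k l.
      by rewrite DE scaleN1r addrC.
    by apply: memvD; [apply: memvZ|]; exact: (ds_kraus_span AT).
  - move=> X; rewrite !DE.
    have e1 : Ad u (Phi (X ^t*)) = (Ad u (Phi X)) ^t* := ds_kraus_adj Pku X.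
    have e2 : Ad u (g (X ^t*)) = (Ad u (g X)) ^t* := ds_kraus_adj gku X.
    by rewrite e1 e2 adjB.
  - have e1 : Ad u (Phi 1%:M) = 1%:M := ds_kraus1 Pku.
    have e2 : Ad u (g 1%:M) = 1%:M := ds_kraus1 gku.
    by rewrite DE e1 e2 subrr.
  move=> i; apply: le_trans Leps; apply: cL => p q'.
  (* Entries of [lin_mx (Ad u)] are products of two entries of a unitary, at most 1 in modulus; the
     pull-back costs a factor [d * d] whatever [u] and [n] are. *)
  rewrite (lin_mx_comp D (Ad_lin u)) mxE.
  apply: le_trans (ler_norm_sum _ _ _) _.
  apply: le_trans (_ : \sum_(j < d * d) eps <= _); last first.
    by rewrite sumr_const card_ord mulr_natl.
  apply: ler_sum => j _; rewrite normrM -[X in _ <= X]mulr1.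
  apply: ler_pM => //.
    case/mxvec_indexP: p => a b; case/mxvec_indexP: j => a' b'.
    by have := close (mxvec_index a b) (mxvec_index a' b'); rewrite !lin_mxE !mxE.
  case/mxvec_indexP: j => a b; case/mxvec_indexP: q' => a' b'.
  rewrite lin_mxE Ad_delta normrM norm_conjC -[X in _ <= X]mulr1.
  by case: uU => _ uu; apply: ler_pM => //; exact: unitary_entry.
exists s'; split=> // [|X].
  by rewrite s2' -[RHS]s2; apply: eq_bigr => q _; rewrite mulr1.
rewrite -s3'; transitivity (iter n (avg t) (avg t X) + D X).
  by rewrite -gE /D addrC subrK.
rewrite s3 -[X in _ + X = _]scale1r -[X in _ + X *: _ = _]s2 scaler_suml.
rewrite -big_split !big_seq.
apply: eq_bigr => q qs /=; have [_ [_ qu]] := s1 _ qs.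
by rewrite (is_linD (Ad_lin q.2)) AdK // [RHS]scalerDr.
Qed.

End Assembly.

Theorem theorem3p4 (R : realType) (d : nat) (A : {pred 'M[R[i]]_d})
  (E : 'M[R[i]]_d -> 'M[R[i]]_d) (N : 'M[R[i]]_(d * d, d * d) -> R) :
  unital_Cstar_subalg A -> HS_orth_proj A E -> is_norm_linmaps N ->
  exists r : R, 0 < r /\
    forall Phi : 'M[R[i]]_d -> 'M[R[i]]_d,
      fixing_channels A Phi ->
      linmap_norm N (fun X => Phi X - E X) <= r ->
      mixed_unitary Phi.
Proof.
move=> Asub EA Nn; have [d0|d0] := posnP d.
  (* For [d = 0] all matrices coincide. *)
  exists 1; split=> // Phi _ _; exists 1%N, (fun=> 1), (fun=> 1%:M).
  split=> [_|_||X]; rewrite ?big_ord1 ?ler01 //.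
    by apply/unitarymxP; rewrite adj1 mulmx1.
  by apply/matrixP => i; have := ltn_ord i; rewrite [X in (_ < X)%N]d0.
have AT a : a \in A -> a ^t* \in A by case: Asub => _ _ _ _; apply.
have [s [sU span]] := spanning_unitaries A.
pose t := 1%:M :: s ++ [seq u ^t* | u <- s].
have t1 : 1%:M \in t by exact: mem_head.
have tU u : u \in t -> unitary_in A u.
  rewrite inE mem_cat => /or3P[/eqP ->|/sU //|/mapP[v /sU vU ->]].
    exact: unitary_in1.
  exact: (unitary_inT AT).
have tspan u : unitary_in A u ->
    lin_mx (Ad u) \in <<[seq lin_mx (Ad v) | v <- t]>>%VS.
  move=> /span; apply: subvP; apply: sub_span => w /mapP[v vs ->].
  by apply/mapP; exists v; rewrite // inE mem_cat vs orbT.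
have tT : \sum_(u <- t) lin_mx (Ad (u ^t*)) = \sum_(u <- t) lin_mx (Ad u).
  exact: (sum_adj_closed (fun u => lin_mx (Ad u))).
have [L [L0 cL]] := coef_bound t d0.
pose K : R[i] := (size t)%:R; have K0 : 0 < K by rewrite ltr0n.
(* The budget is the uniform weight [K^-1], divided by the coefficient bound [L] and the cost of the
   pull-back. One half covers the distance from [Phi] to [E], the other that from [E] to the
   iterate. *)
pose eps : R[i] := (K * L * (d * d).+1%:R)^-1 / 2.
have eps0 : 0 < eps by rewrite divr_gt0 // invr_gt0 !mulr_gt0 // ltr0n.
have [n nP] := avg_converges Asub EA tU t1 tspan tT eps0.
have [k [k0 kP]] := entry_le_norm Nn.
have epsR : eps = (complex.Re eps)%:C%C.
  by move: eps0; case: eps {nP} => a b; rewrite ltcE /= => /andP[/eqP -> _].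
have eR0 : 0 < complex.Re eps by move: eps0; rewrite {1}epsR ltcR.
(* [k] turns the norm into a bound on entries, and [eps], positive in the complex order, equals its
   real part. *)
exists (complex.Re eps / k); split; first by rewrite divr_gt0.
move=> Phi Phi_fix; rewrite /linmap_norm => close.
have Pk : ds_kraus A Phi := fixing_channel_kraus Asub Phi_fix.
apply: (umix_mixed_unitary (A := A)).
apply: (umix_near_iter (t := t) (L := L) (eps := eps * 2) (n := n)) => //.
  rewrite divfK ?pnatr_eq0 // -/K.
  have -> : L * ((d * d)%:R * (K * L * (d * d).+1%:R)^-1)
      = K^-1 * ((d * d)%:R / (d * d).+1%:R).
    by field; rewrite -natrM addrC natr1 !pnatr_eq0 /= gt_eqF.
  apply: ler_piMr; first by rewrite invr_ge0 ltW.
  by rewrite ler_pdivrMr ?ltr0n // mul1r ler_nat.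
move=> p q; rewrite -[X in X - _](subrK (lin_mx E p q)) -addrA mulr2n mulrDr mulr1.
apply: le_trans (ler_normD _ _) _; apply: lerD; last by rewrite distrC.
rewrite normr_normc epsR lecR.
have -> : lin_mx Phi p q - lin_mx E p q = lin_mx (fun X => Phi X - E X) p q.
  case/mxvec_indexP: p => i j; case/mxvec_indexP: q => i' j'.
  by rewrite !lin_mxE !mxE.
by apply: le_trans (kP _ _ _) _; rewrite mulrC -ler_pdivlMr.
Qed.
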